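(* Consider an anonymized database $\mathbf{X}$ and a labeled correlated database $\mathbf{Y}$, where the database distribution $p_X$, the obfuscation distribution $p_{Y|X}$ and the column repetition distribution $p_S$ are unknown to the matching scheme. Given a seed size $\Lambda_n=\omega(\log n)$, the distribution-agnostic matching capacity is $$C = I(X;Y^S\mid S),$$ where $S\sim p_S$ and $X\sim p_X$ are independent, and $Y^S=(Y_1,\dots,Y_S)$ is such that, conditionally on $(X,S)$, the variables $Y_1,\dots,Y_S$ are i.i.d. with distribution $p_{Y|X}(\cdot\mid X)$.
   Context: All logarithms are base 2, and entropy and mutual information are in bits. $[n]=\{1,\dots,n\}$. $I(X;Y^S\mid S)=\sum_s p_S(s)\,I(X;Y_1,\dots,Y_s)$, where the $s=0$ term is $0$. **Databases.** Let $\mathcal{X}=\{1,\dots,|\mathcal{X}|\}$ be a finite alphabet and $p_X$ a probability distribution with support $\mathcal{X}$. An $(m_n,n,p_X)$ anonymized database is a random $m_n\times n$ matrix $\mathbf{X}=(X_{i,j})$ with i.i.d. entries $X_{i,j}\sim p_X$. The column repetition pattern is $S^n=(S_1,\dots,S_n)$, independent of $\mathbf{X}$, with $S_j$ i.i.d. $\sim p_S$, where $p_S$ has finite integer support $\{0,\dots,s_{\max}\}$. The anonymization function $\sigma_n$ is a uniformly random permutation of $[m_n]$, independent of the rest. The obfuscation distribution $p_{Y|X}$ is a conditional distribution (channel) from $\mathcal{X}$ to $\mathcal{X}$. Put $K_0=0$ and $K_j=\sum_{t=1}^j S_t$. The labeled correlated database $\mathbf{Y}$ is the $m_n\times K_n$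 matrix such that, given $\mathbf{X},S^n,\sigma_n$, its entries are conditionally independent and, for every $i\in[m_n]$, $j\in[n]$ and $1\le s\le S_j$, $$Y_{\sigma_n(i),K_{j-1}+s}\sim p_{Y|X}(\cdot\mid X_{i,j}).$$ So column $j$ of $\mathbf{X}$ appears in $\mathbf{Y}$ as $S_j$ noisy copies, and is deleted if $S_j=0$. **Seeds.** A batch of $\Lambda_n$ seeds is a pair of matrices $(\mathbf{G}^{(1)},\mathbf{G}^{(2)})$ of sizes $\Lambda_n\times n$ and $\Lambda_n\times K_n$. The matrix $\mathbf{G}^{(1)}$ has i.i.d. $p_X$ entries, and $\mathbf{G}^{(2)}$ is obtained from $\mathbf{G}^{(1)}$ by the same mechanism, with the same repetition pattern $S^n$ and the channel $p_{Y|X}$, but without any row permutation (row $i$ of $\mathbf{G}^{(2)}$ corresponds to row $i$ of $\mathbf{G}^{(1)}$). The seed rows are additional rows, not part of $\mathbf{X},\mathbf{Y}$: given $S^n$, the pair $(\mathbf{G}^{(1)},\mathbf{G}^{(2)})$ is independent of $(\mathbf{X},\mathbf{Y},\sigma_n)$. **Growth rate.** The database growth rate is $R=\lim_{n\to\infty}\frac1n\log m_n$. It is assumed that $R>0$. **Achievability and capacity.** A matching scheme is a sequence of maps $\psi_n:(\mathbf{X},\mathbf{Y},\mathbf{G}^{(1)},\mathbf{G}^{(2)})\mapsto\hat\sigma_n$ with $\hat\sigma_n:[m_n]\to[m_n]\cup\{0\}$ (value $0$ meaning a declared error). It is distribution-agnostic if it does not rely on any knowledge of $p_X,p_S,p_{Y|X}$.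 It may use $n$, $m_n$, $\Lambda_n$, $|\mathcal{X}|$, $s_{\max}$ and the following structural facts: the entries of $\mathbf{X}$ are i.i.d., the entries of $S^n$ are i.i.d., $\mathbf{X}$ and $S^n$ are independent, $\sigma_n$ is a uniformly random permutation, the entries of $\mathbf{Y}$ are conditionally independent given $\mathbf{X},S^n,\sigma_n$, each being the output of one and the same (unknown) memoryless channel applied to the corresponding entry of $\mathbf{X}$, and the seeds are generated by the same mechanism with the same $S^n$ and no row permutation. That is, the maps $\psi_n$ are fixed without reference to the triple $(p_X,p_S,p_{Y|X})$, and the same maps are used whatever the triple is. For a given triple $(p_X,p_S,p_{Y|X})$ and seed sizes $\Lambda_n$, a growth rate $R$ is distribution-agnostically achievable if, for databases with row sizes $m_n$ of growth rate $R$, there is a distribution-agnostic matching scheme with $$\lim_{n\to\infty}\Pr\big(\sigma_n(I)\ne\hat\sigma_n(I)\big)=0,$$ where $I$ is uniform on $[m_n]$ and independent of everything else. The distribution-agnostic matching capacity $C$ (for the given $p_X,p_S,p_{Y|X},\Lambda_n$) is the supremum of all distribution-agnostically achievable growth rates, with the supremum of the empty set taken to be $0$. *)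

(* Defs.v *)
From mathcomp Require Import all_boot all_order all_fingroup all_algebra.
From mathcomp Require Import all_classical all_reals all_analysis.
Set Implicit Arguments.
Unset Strict Implicit.
Unset Printing Implicit Defensive.
Import Order.TTheory GRing.Theory Num.Theory.
Import numFieldNormedType.Exports.
Local Open Scope classical_set_scope.
Local Open Scope ring_scope.

Definition log2 {R : realType} (x : R) : R := ln x / ln 2.

(* All the random objects take finitely many values for fixed n, so laws are
   given by probability mass functions. *)
Record dist (R : realType) (T : finType) := Dist {
  pmf :> T -> R;
  pmf_ge0 : forall t, 0 <= pmf t;
  pmf_sum1 : \sum_t pmf t = 1 }.

(* Mutual information, in bits, of a joint pmf.  Terms with p (a, b) = 0
   vanish because the logarithm is multiplied by p (a, b). *)
Definition mutual_info {R : realType} {A B : finType} (p : A * B -> R) : R :=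
  \sum_(a : A) \sum_(b : B)
    p (a, b) * log2 (p (a, b) /
      ((\sum_(b' : B) p (a, b')) * (\sum_(a' : A) p (a', b)))).

(* The unknown triple (p_X, p_S, p_{Y|X}).  The alphabet {1, ..., k} is
   represented by 'I_k and the repetition counts {0, ..., smax} by 'I_smax.+1;
   chan x is p_{Y|X}(. | x). *)
Record source (R : realType) (k smax : nat) := Source {
  pX : dist R 'I_k;
  pS : dist R 'I_smax.+1;
  chan : 'I_k -> dist R 'I_k }.

(* I(X; Y^S | S) = \sum_s p_S(s) I(X; Y_1, ..., Y_s); the term s = 0 is zero,
   since {ffun 'I_0 -> 'I_k} has a single element. *)
Definition cond_mutual_info {R : realType} {k smax : nat}
    (q : source R k smax) : R :=
  \sum_(s : 'I_smax.+1) pS q s *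
    mutual_info (fun xy : 'I_k * {ffun 'I_s -> 'I_k} =>
      pX q xy.1 * \prod_(t : 'I_s) chan q xy.1 (xy.2 t)).

(* K_n *)
Definition ncols {n smax : nat} (S : {ffun 'I_n -> 'I_smax.+1}) : nat :=
  (\sum_(j < n) S j)%N.

(* The s-th copy of column j: by tagnat.RankEsum its value is
   \sum_(i < j) S i + s, with s counted from 0. *)
Definition copy_col {n smax : nat} (S : {ffun 'I_n -> 'I_smax.+1})
    (j : 'I_n) (s : 'I_(S j)) : 'I_(ncols S) :=
  @tagnat.Rank n (fun i => S i : nat) j s.

Section Model.
Variables (R : realType) (k smax : nat) (q : source R k smax).

Definition pattern_pmf n (S : {ffun 'I_n -> 'I_smax.+1}) : R :=
  \prod_j pS q (S j).

Definition iid_pmf m n (X : 'M['I_k]_(m, n)) : R :=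
  \prod_i \prod_j pX q (X i j).

(* Conditional probability of Y given X, S and the row permutation sigma;
   every entry of Y occurs exactly once as Y (sigma i) (copy_col S j s). *)
Definition noisy_pmf m n (S : {ffun 'I_n -> 'I_smax.+1}) (sigma : 'S_m)
    (X : 'M['I_k]_(m, n)) (Y : 'M['I_k]_(m, ncols S)) : R :=
  \prod_(i < m) \prod_(j < n) \prod_(s < S j)
    chan q (X i j) (Y (sigma i) (@copy_col n smax S j s)).

End Model.

(* The matching maps.  Their arguments are n, m_n, Lambda_n, the (observed)
   number of columns K_n and X, Y, G1, G2; the alphabet size k and smax are
   fixed parameters, and nothing depends on a source.  The extra value 0 of
   the estimate (declared error) is None. *)
Definition scheme (k smax : nat) : Type :=
  forall n m L K : nat,
    'M['I_k]_(m, n) -> 'M['I_k]_(m, K) -> 'M['I_k]_(L, n) -> 'M['I_k]_(L, K) ->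
    'I_m -> option 'I_m.

(* Pr(sigma(I) <> hat sigma(I)) for n columns, m rows and L seeds: sum of the
   joint pmf of (S, X, sigma, Y, G1, G2, I) over the error event. *)
Definition error_prob {R : realType} {k smax : nat} (q : source R k smax)
    (psi : scheme k smax) (n m L : nat) : R :=
  \sum_(S : {ffun 'I_n -> 'I_smax.+1})
  \sum_(X : 'M['I_k]_(m, n)) \sum_(sigma : 'S_m)
  \sum_(Y : 'M['I_k]_(m, ncols S))
  \sum_(G1 : 'M['I_k]_(L, n)) \sum_(G2 : 'M['I_k]_(L, ncols S))
  \sum_(i < m | psi n m L (ncols S) X Y G1 G2 i != Some (sigma i))
    pattern_pmf q S * iid_pmf q X * (m`!)%:R^-1 * noisy_pmf q sigma X Y
    * iid_pmf q G1 * noisy_pmf q 1%g G1 G2 * m%:R^-1.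

Definition has_growth_rate {R : realType} (m : nat -> nat) (r : R) : Prop :=
  (fun n => log2 (m n)%:R / n%:R) @ \oo --> r.

(* Lambda_n = omega(log n) *)
Definition superlogarithmic (R : realType) (L : nat -> nat) : Prop :=
  (fun n => (L n)%:R / log2 n%:R : R) @ \oo --> +oo.

(* Achievability and capacity when the scheme must belong to the class A of
   schemes.  A singleton A imposes one scheme, the same for all sources. *)
Definition achievable {R : realType} {k smax : nat} (A : set (scheme k smax))
    (q : source R k smax) (L : nat -> nat) (r : R) : Prop :=
  0 < r /\
  forall m : nat -> nat, (forall n, (0 < m n)%N) -> has_growth_rate m r ->
    exists2 psi, A psi &
      (fun n => error_prob q psi n (m n) (L n)) @ \oo --> (0 : R).

(* The added element 0 makes the supremum of the empty set equal to 0. *)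
Definition capacity {R : realType} {k smax : nat} (A : set (scheme k smax))
    (q : source R k smax) (L : nat -> nat) : \bar R :=
  ereal_sup ([set r%:E | r in [set r : R | achievable A q L r]] `|` [set 0%E]).

(* Main.v *)
(* Achievability.  For a sequence [u] of pairs, [score u] is the ratio of the
   maximum likelihood of [u] over all laws on pairs to the product of the
   maximum likelihoods of its two components; it needs no knowledge of the
   source.  If the components are independent, its expectation is at most the
   number of types, which is polynomial; if they follow a joint law [W], then up
   to polynomial factors it is at least the true likelihood ratio of [W] to the
   product of its marginals, which by Chernoff grows exponentially at the rate
   of the mutual information.  Applied to the pairs of seed columns, over which a
   union bound only costs a polynomial factor, the score reveals the repetition
   pattern, since the number of seeds is superlogarithmic.  Applied to the rows,
   with the copies of a column grouped in one letter, it singles out the true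
   match as soon as [log m / n] stays below the mutual information.

   Converse.  Compare the model with the law in which [Y] is independent of the
   permutation.  The expected log-likelihood ratio is [m n I], while for any
   estimate the number [N] of correct rows satisfies [E[m^N] <= (2e)^m] under the
   second law.  The change-of-measure inequality then gives
   [(1 - P_e) ln m <= n I + O(1)]. *)
Require Import Defs.
From mathcomp Require Import all_boot all_order all_fingroup all_algebra.
From mathcomp Require Import all_classical all_reals all_analysis.
From mathcomp Require Import lra ring.
Set Implicit Arguments.
Unset Strict Implicit.
Unset Printing Implicit Defensive.
Import Order.TTheory GRing.Theory Num.Theory.
Import numFieldNormedType.Exports.
Local Open Scope ring_scope.

(** * Marginals of product laws *)

Section FiniteProducts.
Variable R : realType.

(** Independence survives coordinatewise maps: the fibre over [b] is a product of the fibres over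
    the [b j], so its mass factorizes. *)
Lemma pushforward_prod (J U B : finType) (e : J -> U -> B) (p : J -> U -> R)
    (G : {ffun J -> B} -> R) :
  \sum_(u : {ffun J -> U}) (\prod_j p j (u j)) * G [ffun j => e j (u j)] =
  \sum_(b : {ffun J -> B}) (\prod_j \sum_(v | e j v == b j) p j v) * G b.
Proof.
rewrite (partition_big (fun u : {ffun J -> U} => [ffun j => e j (u j)] : {ffun J -> B}) xpredT) //=.
apply: eq_bigr => b _.
rewrite (bigA_distr_big_dep (fun j v => e j v == b j)) big_distrl /=.
apply: eq_big => [u|u /eqP <- //].
apply/eqP/familyP => [<- j|h]; first by rewrite unfold_in ffunE.
by apply/ffunP => j; rewrite ffunE; apply/eqP; apply: h.
Qed.

(** Coordinates outside the image of [h] are unconstrained and sum to 1; injectivity keeps those in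
    the image distinct. *)
Lemma marginal_prod (I J T : finType) (h : I -> J) (c : J -> T -> R)
    (F : {ffun I -> T} -> R) :
  injective h -> (forall j, \sum_t c j t = 1) ->
  \sum_(y : {ffun J -> T}) (\prod_j c j (y j)) * F [ffun i => y (h i)] =
  \sum_(z : {ffun I -> T}) (\prod_i c (h i) (z i)) * F z.
Proof.
move=> h_inj c1.
rewrite (partition_big (fun y : {ffun J -> T} => [ffun i => y (h i)] : {ffun I -> T}) xpredT) //=.
apply: eq_bigr => z _.
(* [Q j] pins coordinate [j] to [z i] when [j = h i] and leaves it free otherwise, so the fibre over
   [z] is a product set. *)
pose Q j t := [forall i, (h i == j) ==> (z i == t)].
have QE (y : {ffun J -> T}) : ([ffun i => y (h i)] == z) = (y \in family Q).
  apply/eqP/familyP => [zE j|hy].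
    by rewrite unfold_in /Q -zE; apply/forallP => i; apply/implyP => /eqP <-; rewrite ffunE.
  apply/ffunP => i; rewrite ffunE.
  by have /forallP/(_ i) := hy (h i); rewrite eqxx => /eqP.
under eq_bigr => y hy do rewrite (eqP hy).
rewrite -big_distrl /= (eq_bigl _ _ QE) -(bigA_distr_big_dep Q) /=.
congr (_ * _).
rewrite (bigID (fun j => j \in codom h)) /= [X in _ * X]big1 ?mulr1; last first.
  move=> j jh; rewrite -[RHS](c1 j); apply: eq_bigl => t.
  apply/forallP => i; apply/implyP => /eqP hij.
  by case/negP: jh; apply/codomP; exists i.
rewrite (eq_bigl (mem (h @: I))) => [|j]; last first.
  by rewrite inE; apply/codomP/imsetP => [[i ->]|[i _ ->]]; exists i.
rewrite big_imset /=; last by move=> ? ? _ _; apply: h_inj.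
apply: eq_bigr => i _; rewrite (big_pred1 (z i)) // => t.
apply/forallP/eqP => [/(_ i)|-> i']; first by rewrite eqxx => /eqP ->.
by apply/implyP => /eqP /h_inj ->.
Qed.

Lemma sum_mx (T : finType) m n (F : 'M[T]_(m, n) -> R) :
  \sum_X F X = \sum_(f : {ffun 'I_m * 'I_n -> T}) F (\matrix_(i, j) f (i, j)).
Proof.
rewrite (reindex (fun f : {ffun 'I_m * 'I_n -> T} => \matrix_(i, j) f (i, j))) //.
exists (fun X : 'M[T]_(m, n) => [ffun p => X p.1 p.2]) => [f _|X _].
  by apply/ffunP => -[i j]; rewrite ffunE mxE.
by apply/matrixP => i j; rewrite mxE ffunE.
Qed.

Lemma marginal_mx (I T : finType) m n (h : I -> 'I_m * 'I_n)
    (c : 'I_m -> 'I_n -> T -> R) (F : {ffun I -> T} -> R) :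
  injective h -> (forall i j, \sum_t c i j t = 1) ->
  \sum_(X : 'M[T]_(m, n)) (\prod_i \prod_j c i j (X i j)) *
     F [ffun i => X (h i).1 (h i).2] =
  \sum_(z : {ffun I -> T}) (\prod_i c (h i).1 (h i).2 (z i)) * F z.
Proof.
move=> h_inj c1; rewrite sum_mx.
rewrite -(@marginal_prod _ _ _ h (fun p => c p.1 p.2) F h_inj) //.
apply: eq_bigr => f _; congr (_ * F _).
  rewrite pair_big /=; apply: eq_bigr => -[i j] _; by rewrite mxE.
by apply/ffunP => i; rewrite !ffunE mxE -surjective_pairing.
Qed.

Lemma sum_prod_mx (T : finType) m n (c : 'I_m -> 'I_n -> T -> R) :
  (forall i j, \sum_t c i j t = 1) ->
  \sum_(X : 'M[T]_(m, n)) (\prod_i \prod_j c i j (X i j)) = 1.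
Proof.
move=> c1; rewrite sum_mx.
under eq_bigr do rewrite pair_big /=.
under eq_bigr do under eq_bigr do rewrite mxE -surjective_pairing.
rewrite -(bigA_distr_bigA (fun p t => c p.1 p.2 t)) /= big1 // => p _; exact: c1.
Qed.

Lemma sum_ffun_sum (I1 I2 T : finType) (F : {ffun I1 -> T} -> {ffun I2 -> T} -> R) :
  \sum_(z : {ffun I1 + I2 -> T}) F [ffun i => z (inl i)] [ffun i => z (inr i)] =
  \sum_z1 \sum_z2 F z1 z2.
Proof.
rewrite pair_big /=.
rewrite (reindex (fun z : {ffun I1 + I2 -> T} =>
   ([ffun i => z (inl i)] : {ffun I1 -> T}, [ffun i => z (inr i)] : {ffun I2 -> T}))) //=.
exists (fun zz : {ffun I1 -> T} * {ffun I2 -> T} =>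
  [ffun s : I1 + I2 => match s return T with inl i => zz.1 i | inr i => zz.2 i end]).
  by move=> z _; apply/ffunP => -[i|i]; rewrite !ffunE.
by move=> [z1 z2] _; congr (_, _); apply/ffunP => i; rewrite !ffunE.
Qed.

(** Two disjoint families of cells form a single injective family indexed by the sum type, so this
    is again a marginal, and it splits into two independent factors. *)
Lemma marginal2_mx (I1 I2 T : finType) m n (h1 : I1 -> 'I_m * 'I_n)
    (h2 : I2 -> 'I_m * 'I_n) (c : 'I_m -> 'I_n -> T -> R)
    (F : {ffun I1 -> T} -> {ffun I2 -> T} -> R) :
  injective h1 -> injective h2 -> (forall i1 i2, h1 i1 != h2 i2) ->
  (forall i j, \sum_t c i j t = 1) ->
  \sum_(X : 'M[T]_(m, n)) (\prod_i \prod_j c i j (X i j)) *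
     F [ffun i => X (h1 i).1 (h1 i).2] [ffun i => X (h2 i).1 (h2 i).2] =
  \sum_(z1 : {ffun I1 -> T}) \sum_(z2 : {ffun I2 -> T}) (\prod_i c (h1 i).1 (h1 i).2 (z1 i)) *
     (\prod_i c (h2 i).1 (h2 i).2 (z2 i)) * F z1 z2.
Proof.
move=> h1_inj h2_inj h12 c1.
pose h s := match s with inl i => h1 i | inr i => h2 i end.
have h_inj : injective h.
  move=> [i|i] [j|j] //= hh; first by rewrite (h1_inj _ _ hh).
  - by move/eqP: hh; rewrite (negbTE (h12 _ _)).
  - by move/eqP: hh; rewrite eq_sym (negbTE (h12 _ _)).
  by rewrite (h2_inj _ _ hh).
rewrite -sum_ffun_sum.
under [RHS]eq_bigr => z _ do under eq_bigr => i _ do rewrite ffunE.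
under [RHS]eq_bigr => z _ do under [X in _ * X * _]eq_bigr => i _ do rewrite ffunE.
rewrite -[RHS]/(\sum_z (_ * (fun z : {ffun I1 + I2 -> T} => F [ffun i => z (inl i)] [ffun i => z (inr i)]) z)).
transitivity (\sum_(z : {ffun I1 + I2 -> T}) (\prod_s c (h s).1 (h s).2 (z s)) *
  (fun z : {ffun I1 + I2 -> T} => F [ffun i => z (inl i)] [ffun i => z (inr i)]) z).
  rewrite -(marginal_mx _ h_inj c1).
  apply: eq_bigr => X _; congr (_ * F _ _); by apply/ffunP => i; rewrite !ffunE.
by apply: eq_bigr => z _; rewrite big_sumType.
Qed.

Lemma sum_ffun_pair (I A B : finType) (F : {ffun I -> A} -> {ffun I -> B} -> R) :
  \sum_x \sum_y F x y =
  \sum_(u : {ffun I -> A * B}) F [ffun i => (u i).1] [ffun i => (u i).2].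
Proof.
rewrite pair_big /=.
rewrite (reindex (fun u : {ffun I -> A * B} =>
  ([ffun i => (u i).1] : {ffun I -> A}, [ffun i => (u i).2] : {ffun I -> B}))) //=.
exists (fun xy : {ffun I -> A} * {ffun I -> B} => [ffun i => (xy.1 i, xy.2 i)]) => [u _|[x y] _].
  by apply/ffunP => i; rewrite !ffunE -surjective_pairing.
by congr (_, _); apply/ffunP => i; rewrite !ffunE.
Qed.

End FiniteProducts.

(** * Maximum likelihood and scores *)

Section Likelihood.
Variable R : realType.

Definition count_of (T : finType) n (x : {ffun 'I_n -> T}) (a : T) : nat :=
  #|[pred j | x j == a]|.

(** The probability of [x] under its own empirical law, that is, [exp] of [- n] times the empirical
    entropy in nats. *)
Definition max_likelihood (T : finType) n (x : {ffun 'I_n -> T}) : R :=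
  \prod_j ((count_of x (x j))%:R / n%:R).

Lemma count_of_gt0 (T : finType) n (x : {ffun 'I_n -> T}) j : (0 < count_of x (x j))%N.
Proof. by apply/card_gt0P; exists j; rewrite inE. Qed.

Lemma count_of_le (T : finType) n (x : {ffun 'I_n -> T}) a : (count_of x a <= n)%N.
Proof. by rewrite -[leqRHS]card_ord max_card. Qed.

Lemma sum_count_of (T : finType) n (x : {ffun 'I_n -> T}) :
  (\sum_a count_of x a = n)%N.
Proof.
rewrite -[RHS]card_ord -sum1_card (partition_big x xpredT) //=.
by apply: eq_bigr => a _; rewrite sum1_card; apply: eq_card => j; rewrite !inE.
Qed.

Lemma max_likelihood_gt0 (T : finType) n (x : {ffun 'I_n -> T}) : 0 < max_likelihood x.
Proof.
apply: prodr_gt0 => j _; apply: divr_gt0; rewrite ltr0n ?count_of_gt0 //.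
exact: leq_ltn_trans (ltn_ord j).
Qed.

(* Gibbs' inequality, obtained from AM-GM applied to the ratios
   [p (x j) / (count_of x (x j) / n)]. *)
Lemma prod_le_max_likelihood (T : finType) n (p : T -> R) (x : {ffun 'I_n -> T}) :
  (forall a, 0 <= p a) -> \sum_a p a <= 1 -> \prod_j p (x j) <= max_likelihood x.
Proof.
move=> p0 p1; case: n x => [|n] x; first by rewrite /max_likelihood !big_ord0.
pose E j := p (x j) / ((count_of x (x j))%:R / n.+1%:R).
have c0 j : (0 : R) < (count_of x (x j))%:R / n.+1%:R.
  by apply: divr_gt0; rewrite ltr0n ?count_of_gt0.
have -> : \prod_j p (x j) = (\prod_j E j) * max_likelihood x.
  rewrite -big_split /=; apply: eq_bigr => j _.
  by rewrite /E divfK // gt_eqF.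
rewrite ler_piMl ?(ltW (max_likelihood_gt0 x)) //.
have E0 j : 0 <= E j by rewrite divr_ge0 // ltW.
have := leif_AGM (fun j (_ : j \in 'I_n.+1) => E0 j).
rewrite (_ : \prod_(i in 'I_n.+1) E i = \prod_j E j); last exact: eq_bigl.
move=> [/le_trans le_mu _]; apply: le_mu; rewrite card_ord.
apply: exprn_ile1; first by rewrite divr_ge0 // sumr_ge0.
rewrite ler_pdivrMr ?ltr0n // mul1r.
(* Grouped by letter, the occurrences of a letter [a] of [x] contribute [n.+1 * p a] in all to the
   sum of the ratios, so their mean is at most the mass of [p]. *)
rewrite (eq_bigl xpredT) // (partition_big x xpredT) //=.
apply: le_trans (_ : \sum_a p a * n.+1%:R <= _); last first.
  by rewrite -mulr_suml ler_piMl.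
apply: ler_sum => a _.
rewrite (eq_bigr (fun=> p a / ((count_of x a)%:R / n.+1%:R))); last first.
  by move=> j /eqP <-.
rewrite sumr_const -/(count_of x a).
have [->|cn0] := eqVneq (count_of x a) 0%N; first by rewrite mulr0n mulr_ge0.
by rewrite -[X in X <= _]mulr_natr invf_div mulrA divfK // pnatr_eq0.
Qed.

(* Sequences of a given type are weighted by the same product law, whose total
   mass is 1, so that only the number of types matters. *)
Lemma sum_max_likelihood (T : finType) n :
  \sum_(x : {ffun 'I_n -> T}) max_likelihood x <= ((n.+1 ^ #|T|)%N)%:R.
Proof.
pose ty (x : {ffun 'I_n -> T}) : {ffun T -> 'I_n.+1} := [ffun a => inord (count_of x a)].
have tyE x a : ty x a = count_of x a :> nat.
  by rewrite ffunE inordK // ltnS count_of_le.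
rewrite (partition_big ty xpredT) //=.
apply: le_trans (_ : \sum_(t : {ffun T -> 'I_n.+1}) (1 : R) <= _); last first.
  by rewrite sumr_const card_ffun card_ord.
apply: ler_sum => t _.
have [x0 /eqP tx0|no] := pickP [pred x | ty x == t]; last first.
  by rewrite big_pred0 // ler01.
apply: le_trans (_ : \sum_(x : {ffun 'I_n -> T}) \prod_j ((t (x j))%:R / n%:R) <= _).
  rewrite [leRHS](bigID (fun x => ty x == t)) /= ler_wpDr //.
    by apply: sumr_ge0 => x _; apply: prodr_ge0 => j _; rewrite divr_ge0.
  rewrite le_eqVlt; apply/orP; left; apply/eqP; apply: eq_bigr => x /eqP <-.
  by apply: eq_bigr => j _; rewrite tyE.
rewrite -(bigA_distr_bigA (fun j a => (t a)%:R / n%:R : R)) /= big1 // => j _.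
rewrite -mulr_suml -natr_sum -tx0 (eq_bigr _ (fun a _ => tyE x0 a)) sum_count_of.
by rewrite divff // pnatr_eq0 -lt0n (leq_ltn_trans _ (ltn_ord j)).
Qed.

(** * Scores of sequences of pairs *)

Variables A B : finType.

Definition fsts n (u : {ffun 'I_n -> A * B}) : {ffun 'I_n -> A} := [ffun j => (u j).1].
Definition snds n (u : {ffun 'I_n -> A * B}) : {ffun 'I_n -> B} := [ffun j => (u j).2].
Definition zips n (x : {ffun 'I_n -> A}) (y : {ffun 'I_n -> B}) : {ffun 'I_n -> A * B} :=
  [ffun j => (x j, y j)].

(** Equals [exp] of [n] times the empirical mutual information in nats, as in universal decoding by
    maximum mutual information. *)
Definition score n (u : {ffun 'I_n -> A * B}) : R :=
  max_likelihood u / (max_likelihood (fsts u) * max_likelihood (snds u)).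

Lemma score_gt0 n (u : {ffun 'I_n -> A * B}) : 0 < score u.
Proof. by rewrite divr_gt0 ?mulr_gt0 ?max_likelihood_gt0. Qed.

Lemma zips_fsts_snds n (u : {ffun 'I_n -> A * B}) : zips (fsts u) (snds u) = u.
Proof. by apply/ffunP => j; rewrite !ffunE -surjective_pairing. Qed.

(** Markov's inequality: the product law gives [u] at most the product of the two maximum
    likelihoods, so its weight times [score u] is at most [max_likelihood u], whose sum is bounded
    by the number of types. *)
Lemma score_indep n (P : A -> R) (Q : B -> R) t :
  (forall a, 0 <= P a) -> \sum_a P a <= 1 ->
  (forall b, 0 <= Q b) -> \sum_b Q b <= 1 -> 0 < t ->
  \sum_(u : {ffun 'I_n -> A * B}) (\prod_j (P (u j).1 * Q (u j).2)) * (t < score u)%R%:R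
    <= ((n.+1 ^ (#|A| * #|B|))%N)%:R / t.
Proof.
move=> P0 P1 Q0 Q1 t0.
rewrite -card_prod ler_pdivlMr // mulr_suml.
apply: le_trans (sum_max_likelihood _ _); apply: ler_sum => u _.
case: ltP => [lt_t|_]; last by rewrite mulr0 mul0r ltW // max_likelihood_gt0.
rewrite mulr1.
have PQ : \prod_j (P (u j).1 * Q (u j).2) <= max_likelihood (fsts u) * max_likelihood (snds u).
  rewrite big_split /=; apply: ler_pM; try by apply: prodr_ge0.
    apply: le_trans (prod_le_max_likelihood (fsts u) P0 P1).
    by rewrite (eq_bigr (fun j => P (fsts u j))) // => j _; rewrite ffunE.
  apply: le_trans (prod_le_max_likelihood (snds u) Q0 Q1).
  by rewrite (eq_bigr (fun j => Q (snds u j))) // => j _; rewrite ffunE.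
apply: le_trans (_ : max_likelihood (fsts u) * max_likelihood (snds u) * score u <= _).
  apply: ler_pM => //; first by apply: prodr_ge0 => j _; rewrite mulr_ge0.
  - exact: ltW.
  - exact: ltW.
by rewrite mulrC divfK // mulf_neq0 // gt_eqF ?max_likelihood_gt0.
Qed.

(** The exponential moment equals 1 at [l = 0] and its derivative there is the negative mean of [h];
    an explicit small [l] is exhibited. *)
Lemma exp_moment_lt1 (T : finType) (W h : T -> R) :
  (forall v, 0 <= W v) -> \sum_v W v = 1 -> \sum_v W v * h v < 0 ->
  exists2 l, 0 < l & \sum_v W v * expR (l * h v) < 1.
Proof.
move=> W0 W1; set e := \sum_v _ => e0.
(* [M] bounds every [h v] in absolute value, and [l] makes [l * e + 2 * (l * M) ^+ 2] equal to
   [l * e / 2 < 0]. The summand [1 - e] in [M] ensures [l * M <= 1 / 4]. *)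
pose M := 1 - e + \sum_v `|h v|.
have M1 : 1 - e <= M by rewrite lerDl sumr_ge0.
have M0 : 1 < M by lra.
have hM v : `|h v| <= M.
  by rewrite /M (bigD1 v) //= addrCA lerDl addr_ge0 ?sumr_ge0 //; lra.
pose l := - e / (4 * M ^+ 2).
have M20 : 0 < 4 * M ^+ 2 by rewrite mulr_gt0 // exprn_gt0 //; lra.
have lE : l * M ^+ 2 = - e / 4 by rewrite /l; field; lra.
have l0 : 0 < l by rewrite divr_gt0 //; lra.
exists l => //.
have lM : l * M <= 1 / 4.
  rewrite -(@ler_pM2r _ M); last lra.
  by rewrite -mulrA -expr2 lE; lra.
apply: le_lt_trans (_ : \sum_v (W v + l * (W v * h v) + 2 * (l * M) ^+ 2 * W v) < _); last first.
  rewrite !big_split /= -!mulr_sumr W1 -/e exprMn.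
  rewrite (_ : 2 * (l ^+ 2 * M ^+ 2) = 2 * l * (l * M ^+ 2)); last by ring.
  rewrite lE; nra.
apply: ler_sum => v _.
rewrite (_ : _ + _ + _ = W v * (1 + l * h v + 2 * (l * M) ^+ 2)); last by ring.
rewrite ler_wpM2l //; set x := l * h v.
have xM : `|x| <= l * M by rewrite normrM (gtr0_norm l0) ler_pM2l.
have x2 : x ^+ 2 <= (l * M) ^+ 2.
  by rewrite -real_normK ?num_real // ler_sqr ?nnegrE // mulr_ge0 //; lra.
have x4 : x <= 1 / 4 by apply: le_trans (ler_norm _) (le_trans xM lM).
(* For [x <= 1 / 4], [expR x] is at most [1 / (1 - x)], which is at most [1 + x + 2 * x ^+ 2]. *)
apply: le_trans (_ : (1 - x)^-1 <= _).
  rewrite -[x in expR x]opprK expRN lef_pV2 ?posrE ?expR_gt0 //; last lra.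
  exact: expR_ge1Dx.
rewrite -div1r ler_pdivrMr; last lra.
by nra.
Qed.

Section JointLaw.
Variable W : A * B -> R.
Hypotheses (W0 : forall v, 0 <= W v) (W1 : \sum_v W v = 1).

Definition marg1 a := \sum_b W (a, b).
Definition marg2 b := \sum_a W (a, b).

Lemma marg1_ge0 a : 0 <= marg1 a. Proof. exact: sumr_ge0. Qed.
Lemma marg2_ge0 b : 0 <= marg2 b. Proof. exact: sumr_ge0. Qed.

Lemma sum_marg1 : \sum_a marg1 a = 1.
Proof. by rewrite -W1 pair_big /=; apply: eq_bigr => -[]. Qed.

Lemma sum_marg2 : \sum_b marg2 b = 1.
Proof. by rewrite exchange_big -W1 pair_big /=; apply: eq_bigr => -[]. Qed.

Lemma le_marg1 v : W v <= marg1 v.1.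
Proof.
by case: v => a b; rewrite /marg1 (bigD1 b) //= lerDl sumr_ge0.
Qed.

Lemma le_marg2 v : W v <= marg2 v.2.
Proof.
by case: v => a b; rewrite /marg2 (bigD1 a) //= lerDl sumr_ge0.
Qed.

Lemma sum_fst_eq a : \sum_(v | v.1 == a) W v = marg1 a.
Proof.
rewrite (eq_bigl (fun v => (v.1 == a) && true)) => [|v]; last by rewrite andbT.
rewrite (eq_bigr (fun v => W (v.1, v.2))) => [|[]//].
rewrite -(pair_big_dep (fun a' => a' == a) (fun _ _ => true) (fun a' b => W (a', b))) /=.
by rewrite big_pred1_eq.
Qed.

Lemma sum_snd_eq b : \sum_(v | v.2 == b) W v = marg2 b.
Proof.
rewrite (eq_bigr (fun v => W (v.1, v.2))) => [|[]//].
rewrite -(pair_big_dep xpredT (fun _ b' => b' == b) (fun a b' => W (a, b'))) /=.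
by apply: eq_bigr => a _; rewrite big_pred1_eq.
Qed.

Lemma sum_fsts n (F : {ffun 'I_n -> A} -> R) :
  \sum_(u : {ffun 'I_n -> A * B}) (\prod_j W (u j)) * F (fsts u) =
  \sum_(x : {ffun 'I_n -> A}) (\prod_j marg1 (x j)) * F x.
Proof.
rewrite (pushforward_prod (fun _ => fst) (fun=> W)).
apply: eq_bigr => x _; congr (_ * _); apply: eq_bigr => j _.
by rewrite sum_fst_eq.
Qed.

Lemma sum_snds n (F : {ffun 'I_n -> B} -> R) :
  \sum_(u : {ffun 'I_n -> A * B}) (\prod_j W (u j)) * F (snds u) =
  \sum_(y : {ffun 'I_n -> B}) (\prod_j marg2 (y j)) * F y.
Proof.
rewrite (pushforward_prod (fun _ => snd) (fun=> W)).
apply: eq_bigr => x _; congr (_ * _); apply: eq_bigr => j _.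
by rewrite sum_snd_eq.
Qed.

(** Outside the events [e1] and [e2], each component has maximum likelihood below [v] times its true
    probability. A score at most [t] then forces the true likelihood ratio below [t * v ^+ 2]. Each
    exceptional event costs the number of types divided by [v]. *)
Lemma score_joint n (t v : R) : 0 < v ->
  \sum_(u : {ffun 'I_n -> A * B}) (\prod_j W (u j)) * (score u <= t)%R%:R <=
  ((n.+1 ^ #|A|)%N)%:R / v + ((n.+1 ^ #|B|)%N)%:R / v +
  \sum_(u : {ffun 'I_n -> A * B}) (\prod_j W (u j)) *
     (\prod_j W (u j) <= t * v ^+ 2 * \prod_j (marg1 (u j).1 * marg2 (u j).2))%R%:R.
Proof.
move=> v0.
pose e1 (x : {ffun 'I_n -> A}) := (v * \prod_j marg1 (x j) <= max_likelihood x)%R.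
pose e2 (x : {ffun 'I_n -> B}) := (v * \prod_j marg2 (x j) <= max_likelihood x)%R.
pose e3 (u : {ffun 'I_n -> A * B}) :=
  (\prod_j W (u j) <= t * v ^+ 2 * \prod_j (marg1 (u j).1 * marg2 (u j).2))%R.
have pW0 (u : {ffun 'I_n -> A * B}) : 0 <= \prod_j W (u j) by apply: prodr_ge0.
apply: le_trans (_ : \sum_(u : {ffun 'I_n -> A * B}) ((\prod_j W (u j)) * (e1 (fsts u))%:R
   + (\prod_j W (u j)) * (e2 (snds u))%:R + (\prod_j W (u j)) * (e3 u)%:R) <= _).
  apply: ler_sum => u _; rewrite -!mulrDr ler_wpM2l // -!natrD ler_nat.
  case: leP => // sct; case E1: (e1 _) => //; case E2: (e2 _) => //.
  rewrite !add0n lt0b; move/negbT: E1; move/negbT: E2; rewrite -!ltNge => E2 E1.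
  apply: le_trans (prod_le_max_likelihood u W0 _) _; first by rewrite W1.
  have := sct; rewrite /score ler_pdivrMr ?mulr_gt0 ?max_likelihood_gt0 // => /le_trans; apply.
  have t0 : 0 < t by apply: lt_le_trans sct; apply: score_gt0.
  rewrite -mulrA ler_pM2l // big_split /= expr2 mulrACA.
  apply: ler_pM; rewrite ?ltW ?max_likelihood_gt0 //.
    by apply: lt_le_trans E1 _; rewrite (eq_bigr (fun j => marg1 (u j).1)) // => j _; rewrite ffunE.
  by apply: lt_le_trans E2 _; rewrite (eq_bigr (fun j => marg2 (u j).2)) // => j _; rewrite ffunE.
rewrite !big_split /= lerD2r.
rewrite (sum_fsts (fun x => (e1 x)%:R)) (sum_snds (fun x => (e2 x)%:R)).
apply: lerD; rewrite ler_pdivlMr // mulr_suml; apply: le_trans (sum_max_likelihood _ _);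
  apply: ler_sum => x _.
  have [h|_] := boolP (e1 x); last by rewrite mulr0 mul0r ltW // max_likelihood_gt0.
  by rewrite mulr1 mulrC.
have [h|_] := boolP (e2 x); last by rewrite mulr0 mul0r ltW // max_likelihood_gt0.
by rewrite mulr1 mulrC.
Qed.

(** * Information density, mutual information in nats and the Chernoff bound *)

Definition info_density v : R := ln (W v / (marg1 v.1 * marg2 v.2)).
Definition mutual_nats : R := \sum_v W v * info_density v.

Lemma marg12_gt0 v : 0 < W v -> 0 < marg1 v.1 * marg2 v.2.
Proof.
by move=> Wv; rewrite mulr_gt0 // (lt_le_trans Wv) // ?le_marg1 ?le_marg2.
Qed.

Lemma sum_marg12 : \sum_v marg1 v.1 * marg2 v.2 = 1.
Proof.
rewrite -(pair_bigA _ (fun a b => marg1 a * marg2 b)) /=.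
under eq_bigr do rewrite -mulr_sumr sum_marg2 mulr1.
exact: sum_marg1.
Qed.

(** This is [ln y <= y - 1] at [y = marg1 v.1 * marg2 v.2 / W v]; both sides of its sum over [v]
    then give nonnegativity of the mutual information. *)
Lemma info_density_ge v : W v - marg1 v.1 * marg2 v.2 <= W v * info_density v.
Proof.
have [->|Wv] := eqVneq (W v) 0.
  by rewrite mul0r sub0r oppr_le0 mulr_ge0 ?marg1_ge0 ?marg2_ge0.
have {}Wv : 0 < W v by rewrite lt_def Wv W0.
have PQ := marg12_gt0 Wv.
rewrite /info_density -[W v / _]invrK lnV ?posrE ?invr_gt0 ?divr_gt0 // invf_div mulrN.
rewrite lerNr opprB.
have := le_ln1Dx (_ : -1 < marg1 v.1 * marg2 v.2 / W v - 1).
rewrite addrCA subrr addr0 => h.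
apply: le_trans (_ : W v * (marg1 v.1 * marg2 v.2 / W v - 1) <= _).
  by rewrite ler_pM2l // h // ltrBrDr addNr divr_gt0.
by rewrite mulrBr mulr1 mulrC divfK // gt_eqF.
Qed.

Lemma mutual_nats_ge0 : 0 <= mutual_nats.
Proof.
apply: le_trans (_ : \sum_v (W v - marg1 v.1 * marg2 v.2) <= _).
  by rewrite sumrB W1 sum_marg12 subrr.
by apply: ler_sum => v _; apply: info_density_ge.
Qed.

(** [W] and the product of its marginals both have mass 1, so if they differ, [W] is the larger one
    at some [v]; there [ln y <= y - 1] is strict. *)
Lemma mutual_nats_gt0 v0 : W v0 != marg1 v0.1 * marg2 v0.2 -> 0 < mutual_nats.
Proof.
move=> ne.
have [v lt_v] : exists v, marg1 v.1 * marg2 v.2 < W v.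
  apply/existsP; rewrite -[X in is_true X]negbK negb_exists; apply/negP => /forallP h.
  have d0 v : true -> 0 <= marg1 v.1 * marg2 v.2 - W v.
    by move=> _; rewrite subr_ge0 leNgt; apply: h.
  have /eqP := sumrB (index_enum (A * B)%type) xpredT (fun v => marg1 v.1 * marg2 v.2) W.
  rewrite sum_marg12 W1 subrr psumr_eq0 // => /allP /(_ v0).
  by rewrite mem_index_enum subr_eq0 eq_sym (negbTE ne) => /(_ isT).
have Wv : 0 < W v.
  by apply: le_lt_trans lt_v; rewrite mulr_ge0 ?marg1_ge0 ?marg2_ge0.
have PQ := marg12_gt0 Wv.
have <- : \sum_v (W v - marg1 v.1 * marg2 v.2) = 0.
  by rewrite sumrB W1 sum_marg12 subrr.
rewrite /mutual_nats (bigD1 v) //= [ltRHS](bigD1 v) //=.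
apply: ltr_leD; last by apply: ler_sum => w _; apply: info_density_ge.
set y := (marg1 v.1 * marg2 v.2) in PQ lt_v *.
rewrite /info_density -/y -[W v / y]invrK lnV ?posrE ?invr_gt0 ?divr_gt0 // invf_div mulrN.
rewrite ltrNr opprB.
have lny : ln (y / W v) != 0.
  by rewrite ln_eq0 ?divr_gt0 // lt_eqF // ltr_pdivrMr ?mul1r.
have := expR_gt1Dx lny; rewrite lnK ?posrE ?divr_gt0 // => h.
rewrite (_ : y - W v = W v * (y / W v - 1)); last first.
  by rewrite mulrBr mulr1 mulrCA divff ?mulr1 // gt_eqF.
by rewrite ltr_pM2l // ltrBrDr addrC.
Qed.

(** The variable [h] has mean [- eps], so some exponential moment [b] of it is below 1. On the event
    considered the sum of the [h (u j)] is nonnegative, hence the indicator is at most the product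
    of the [expR (l * h (u j))], of expectation [b ^+ n]. *)
Lemma chernoff (eps : R) : 0 < eps ->
  exists b : R, [/\ 0 <= b, b < 1 & forall n t, t <= expR (n%:R * (mutual_nats - eps)) ->
    \sum_(u : {ffun 'I_n -> A * B}) (\prod_j W (u j)) *
      (\prod_j W (u j) <= t * \prod_j (marg1 (u j).1 * marg2 (u j).2))%R%:R <= b ^+ n].
Proof.
move=> eps0; pose h v := mutual_nats - eps - info_density v.
have hW : \sum_v W v * h v = - eps.
  under eq_bigr do rewrite mulrBr.
  by rewrite sumrB -mulr_suml W1 mul1r -/mutual_nats addrAC subrr add0r.
have hW0 : \sum_v W v * h v < 0 by rewrite hW oppr_lt0.
have [l l0 l1] := exp_moment_lt1 W0 W1 hW0.
exists (\sum_v W v * expR (l * h v)); split.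
- by apply: sumr_ge0 => v _; rewrite mulr_ge0 // expR_ge0.
- exact: l1.
move=> n t t_le.
rewrite (_ : _ ^+ n = \sum_(u : {ffun 'I_n -> A * B}) \prod_j (W (u j) * expR (l * h (u j)))); last first.
  by rewrite -(bigA_distr_bigA (fun _ v => W v * expR (l * h v))) prodr_const card_ord.
apply: ler_sum => u _.
have rhs0 : 0 <= \prod_j (W (u j) * expR (l * h (u j))).
  by apply: prodr_ge0 => j _; rewrite mulr_ge0 // expR_ge0.
have [le_t|_] := boolP (\prod_j W (u j) <= t * _); last by rewrite mulr0.
rewrite mulr1 big_split /= -expR_sum -mulr_sumr.
have [/eqP W_eq0|W_neq0] := eqVneq (\prod_j W (u j)) 0; first by rewrite (eqP W_eq0) mul0r.
have Wj j : 0 < W (u j).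
  by rewrite lt_def W0 andbT; move/prodf_neq0: W_neq0; apply.
rewrite ler_peMr ?prodr_ge0 // -expR0 ler_expR mulr_ge0 ?(ltW l0) //.
rewrite /h sumrB sumr_const card_ord subr_ge0 -mulr_natl.
rewrite -ler_expR expR_sum; apply: le_trans t_le.
under eq_bigr => j _ do rewrite /info_density lnK ?posrE ?divr_gt0 ?marg12_gt0 //.
rewrite prodf_div ler_pdivrMr ?le_t //.
by apply: prodr_gt0 => j _; apply: marg12_gt0.
Qed.

End JointLaw.
End Likelihood.

(** * Laws of rows and columns of the databases *)

Section RowLaw.
Variables (R : realType) (k' smax : nat).
Notation k := k'.+1.
Notation block := {s : 'I_smax.+1 & {ffun 'I_s -> 'I_k}}.
Notation mkblock s := (@Tagged 'I_smax.+1 s (fun s0 : 'I_smax.+1 => {ffun 'I_s0 -> 'I_k})).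

(* The letter [ord0] is a junk value, never reached when [K] is [ncols S]. *)
Definition blocks n K (S : {ffun 'I_n -> 'I_smax.+1}) (y : {ffun 'I_K -> 'I_k}) :
    {ffun 'I_n -> block} :=
  [ffun j => mkblock (S j) [ffun t : 'I_(S j) =>
     if insub (\sum_(i < n | (i < j)%N) S i + t)%N is Some c then y c else ord0]].

(** [col_of] and [pos_of] invert [copy_col]: column [c] of [Y] is copy [pos_of c] of column
    [col_of c] of [X]. *)
Definition col_of n (S : {ffun 'I_n -> 'I_smax.+1}) (c : 'I_(ncols S)) : 'I_n :=
  @tagnat.sig1 n (fun i => S i : nat) c.
Definition pos_of n (S : {ffun 'I_n -> 'I_smax.+1}) (c : 'I_(ncols S)) : 'I_(S (col_of c)) :=
  @tagnat.sig2 n (fun i => S i : nat) c.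

Lemma col_of_copy n (S : {ffun 'I_n -> 'I_smax.+1}) j (t : 'I_(S j)) :
  col_of (copy_col t) = j.
Proof. exact: tagnat.Rank1K. Qed.

Lemma copy_col_inj n (S : {ffun 'I_n -> 'I_smax.+1}) j : injective (@copy_col n smax S j).
Proof.
move=> s t /(congr1 val) /eqP; rewrite /copy_col tagnat.eq_Rank eqxx /=.
by move/eqP/val_inj.
Qed.

(** [blocks] accepts any [K] because the matcher applies it with an estimated pattern; with the true
    pattern its indices are those of [copy_col]. *)
Lemma blocksE n (S : {ffun 'I_n -> 'I_smax.+1}) (y : {ffun 'I_(ncols S) -> 'I_k}) :
  blocks S y = [ffun j => mkblock (S j) [ffun t => y (@copy_col n smax S j t)]].
Proof.
apply/ffunP => j; rewrite !ffunE; congr Tagged; apply/ffunP => t; rewrite !ffunE.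
case: insubP => [c _ cE|]; first by congr (y _); apply: val_inj; rewrite cE -tagnat.RankEsum.
by rewrite -(tagnat.RankEsum (p_ := fun i => S i : nat)) ltn_ord.
Qed.

Variable q : source R k smax.

Lemma chan_sum1 x : \sum_y chan q x y = 1. Proof. exact: pmf_sum1. Qed.
Lemma chan_ge0 x y : 0 <= chan q x y. Proof. exact: (Defs.pmf_ge0 (chan q x) y). Qed.
Lemma pX_ge0 x : 0 <= pX q x. Proof. exact: (Defs.pmf_ge0 (pX q) x). Qed.
Lemma pS_ge0 s : 0 <= pS q s. Proof. exact: (Defs.pmf_ge0 (pS q) s). Qed.

(** Reindexing rows by [sigma] and columns by the bijection with pairs (column, copy) displays the
    law as a product over the cells of [Y], the form that the marginal lemmas need. *)
Lemma noisy_pmfE m n (S : {ffun 'I_n -> 'I_smax.+1}) (sigma : 'S_m)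
    (X : 'M['I_k]_(m, n)) (Y : 'M['I_k]_(m, ncols S)) :
  noisy_pmf q sigma X Y =
  \prod_i \prod_c chan q (X ((sigma^-1)%g i) (col_of c)) (Y i c).
Proof.
rewrite [RHS](reindex_inj (@perm_inj _ sigma)) /=; apply: eq_bigr => i _.
rewrite permK sig_big_dep /=.
rewrite (reindex (@tagnat.sig n (fun i => S i : nat))) /=; last exact: tagnat.sig_bij_on.
apply: eq_bigr => c _; congr (chan q _ (Y _ _)).
exact: (@tagnat.sig2K n (fun i => S i : nat)).
Qed.

(** The channel from a letter to its repetition count together with its noisy copies. With such
    blocks as output letters, a row is a memoryless channel of length [n]. *)
Definition block_chan (x : 'I_k) (b : block) : R :=
  pS q (tag b) * \prod_(t < tag b) chan q x (tagged b t).

Definition block_law (v : 'I_k * block) : R := pX q v.1 * block_chan v.1 v.2.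

(** Blocks have a type depending on the pattern. Drawing [smax] copies in every column and keeping
    the first [s] gives a representation over a fixed type. *)
Let fill (s : 'I_smax.+1) (y : {ffun 'I_smax -> 'I_k}) : block :=
  mkblock s [ffun t : 'I_s => y (widen_ord (ltn_ord s : (s <= smax)%N) t)].

Lemma sum_fill x b :
  \sum_(v : 'I_smax.+1 * {ffun 'I_smax -> 'I_k} | fill v.1 v.2 == b)
     pS q v.1 * \prod_t chan q x (v.2 t) = block_chan x b.
Proof.
case: b => s z; rewrite /block_chan /=.
rewrite -(pair_big_dep xpredT (fun s' y => fill s' y == mkblock s z)
           (fun s' (y : {ffun 'I_smax -> 'I_k}) => pS q s' * \prod_t chan q x (y t))) /=.
rewrite (bigD1 s) //= [X in _ + X]big1 ?addr0; last first.
  move=> s' ne; rewrite big_pred0 // => y; apply/negP => /eqP.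
  by move/(congr1 tag) => /= ss; rewrite ss eqxx in ne.
rewrite -mulr_sumr; congr (_ * _).
have fillE y : (fill s y == mkblock s z) =
    ([ffun t : 'I_s => y (widen_ord (ltn_ord s : (s <= smax)%N) t)] == z).
  exact: (@eq_Tagged _ (fun s0 : 'I_smax.+1 => {ffun 'I_s0 -> 'I_k} : eqType) (fill s y) z).
rewrite (eq_bigl _ _ fillE).
pose h := widen_ord (ltn_ord s : (s <= smax)%N).
have h_inj : injective h by move=> a b /(congr1 val) /= /val_inj.
have := marginal_prod (fun z' => (z' == z)%:R) h_inj (fun _ => chan_sum1 x).
rewrite (bigD1 z) //= [X in _ = _ + X -> _]big1 => [|z' /negbTE ->]; last by rewrite mulr0.
rewrite eqxx mulr1 addr0 => <-; rewrite big_mkcond /=.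
by apply: eq_bigr => y _; case: (_ == z); rewrite ?mulr1 ?mulr0.
Qed.

(** Averaging over the pattern makes the blocks of a row conditionally independent: both sides are
    images of the same padded array of [n] by [smax] noisy copies. *)
Lemma law_blocks n (x : {ffun 'I_n -> 'I_k}) (G : {ffun 'I_n -> block} -> R) :
  \sum_(S : {ffun 'I_n -> 'I_smax.+1}) pattern_pmf q S *
    (\sum_(y : {ffun 'I_(ncols S) -> 'I_k})
       (\prod_c chan q (x (col_of c)) (y c)) * G (blocks S y)) =
  \sum_(b : {ffun 'I_n -> block}) (\prod_j block_chan (x j) (b j)) * G b.
Proof.
transitivity (\sum_(S : {ffun 'I_n -> 'I_smax.+1}) \sum_(z : {ffun 'I_n -> {ffun 'I_smax -> 'I_k}})
   (\prod_j (pS q (S j) * \prod_t chan q (x j) (z j t))) * G [ffun j => fill (S j) (z j)]).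
  apply: eq_bigr => S _; rewrite mulr_sumr.
  under [RHS]eq_bigr do rewrite big_split /= -mulrA.
  rewrite -!mulr_sumr; congr (_ * _).
  (* The cell of the padded array in which column [c] of [Y] sits; the other cells are summed
     out. *)
  pose h (c : 'I_(ncols S)) : 'I_n * 'I_smax :=
    (col_of c, widen_ord (ltn_ord (S (col_of c)) : (S (col_of c) <= smax)%N) (pos_of c)).
  have h_inj : injective h.
    move=> c d [h1 h2]; apply: ord_inj.
    rewrite -(@tagnat.sig2K n (fun i => S i : nat) c) -(@tagnat.sig2K n (fun i => S i : nat) d).
    apply/eqP; rewrite tagnat.eq_Rank; apply/andP; split; apply/eqP => //.
  rewrite -(marginal_prod _ h_inj (c := fun p => chan q (x p.1))) //; last first.
    by move=> p; apply: chan_sum1.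
  rewrite (reindex (fun z : {ffun 'I_n -> {ffun 'I_smax -> 'I_k}} =>
     [ffun p : 'I_n * 'I_smax => z p.1 p.2])) /=; last first.
    exists (fun y : {ffun 'I_n * 'I_smax -> 'I_k} => [ffun j => [ffun t => y (j, t)]]).
      by move=> z _; apply/ffunP => j; apply/ffunP => t; rewrite !ffunE.
    by move=> y _; apply/ffunP => -[j t]; rewrite !ffunE.
  apply: eq_bigr => z _; rewrite blocksE; congr (_ * G _).
    by rewrite pair_big; apply: eq_bigr => -[j t] _; rewrite ffunE.
  apply/ffunP => j; rewrite !ffunE; congr Tagged; apply/ffunP => t; rewrite !ffunE.
  congr (z _ _); rewrite /h /=; first exact: col_of_copy.
  apply: val_inj => /=.
  by rewrite /pos_of /copy_col tagnat.Rank2K.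
rewrite sum_ffun_pair.
rewrite -(eq_bigr _ (fun b _ => congr1 (fun r => r * G b) (eq_bigr _ (fun j _ => sum_fill (x j) (b j))))).
rewrite -(pushforward_prod (fun _ v => fill v.1 v.2) (fun j v => pS q v.1 * \prod_t chan q (x j) (v.2 t))).
apply: eq_bigr => u _; congr (_ * G _).
  by apply: eq_bigr => j _; rewrite !ffunE; congr (_ * _); apply: eq_bigr => t _; rewrite ?ffunE.
by apply/ffunP => j; rewrite !ffunE.
Qed.

End RowLaw.

Section DatabaseLaw.
Variables (R : realType) (k' smax : nat).
Notation k := k'.+1.
Notation block := {s : 'I_smax.+1 & {ffun 'I_s -> 'I_k}}.
Variable q : source R k smax.

Definition row_of (T : Type) m n (X : 'M[T]_(m, n)) i : {ffun 'I_n -> T} := [ffun j => X i j].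
Definition column_of (T : Type) m n (X : 'M[T]_(m, n)) j : {ffun 'I_m -> T} := [ffun i => X i j].

Lemma pX_sum1 : \sum_x pX q x = 1. Proof. exact: pmf_sum1. Qed.
Lemma pS_sum1 : \sum_s pS q s = 1. Proof. exact: pmf_sum1. Qed.

Lemma sum_iid m n : \sum_(X : 'M['I_k]_(m, n)) iid_pmf q X = 1.
Proof. exact: (sum_prod_mx (fun _ _ => pX_sum1)). Qed.

Lemma sum_pattern n : \sum_(S : {ffun 'I_n -> 'I_smax.+1}) pattern_pmf q S = 1.
Proof.
rewrite -(bigA_distr_bigA (fun _ s => pS q s)) /= big1 // => _ _; exact: pS_sum1.
Qed.

Lemma sum_noisy m n (S : {ffun 'I_n -> 'I_smax.+1}) (sigma : 'S_m) (X : 'M['I_k]_(m, n)) :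
  \sum_(Y : 'M['I_k]_(m, ncols S)) noisy_pmf q sigma X Y = 1.
Proof.
under eq_bigr do rewrite noisy_pmfE.
by rewrite (sum_prod_mx (c := fun i c => chan q (X ((sigma^-1)%g i) (col_of c)))) // => *;
  apply: chan_sum1.
Qed.

Lemma iid_pmf_ge0 m n (X : 'M['I_k]_(m, n)) : 0 <= iid_pmf q X.
Proof. by apply: prodr_ge0 => i _; apply: prodr_ge0 => j _; apply: pX_ge0. Qed.

Lemma pattern_pmf_ge0 n (S : {ffun 'I_n -> 'I_smax.+1}) : 0 <= pattern_pmf q S.
Proof. by apply: prodr_ge0 => j _; apply: pS_ge0. Qed.

Lemma noisy_pmf_ge0 m n (S : {ffun 'I_n -> 'I_smax.+1}) (sigma : 'S_m)
    (X : 'M['I_k]_(m, n)) (Y : 'M['I_k]_(m, ncols S)) : 0 <= noisy_pmf q sigma X Y.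
Proof.
by do 3![apply: prodr_ge0 => ? _]; apply: chan_ge0.
Qed.

Lemma iid_vec (T : finType) m n (p : T -> R) (I : finType) (h : I -> 'I_m * 'I_n)
    (F : {ffun I -> T} -> R) : injective h -> \sum_t p t = 1 ->
  \sum_(X : 'M[T]_(m, n)) (\prod_i \prod_j p (X i j)) * F [ffun i => X (h i).1 (h i).2] =
  \sum_(x : {ffun I -> T}) (\prod_i p (x i)) * F x.
Proof. by move=> h_inj p1; rewrite (marginal_mx (c := fun _ _ => p)). Qed.

Lemma iid_row m n (i : 'I_m) (F : {ffun 'I_n -> 'I_k} -> R) :
  \sum_(X : 'M['I_k]_(m, n)) iid_pmf q X * F (row_of X i) =
  \sum_(x : {ffun 'I_n -> 'I_k}) (\prod_j pX q (x j)) * F x.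
Proof.
by rewrite -(iid_vec (h := fun j => (i, j)) _ _ pX_sum1) // => ? ? [].
Qed.

Lemma iid_column m n (j : 'I_n) (F : {ffun 'I_m -> 'I_k} -> R) :
  \sum_(X : 'M['I_k]_(m, n)) iid_pmf q X * F (column_of X j) =
  \sum_(x : {ffun 'I_m -> 'I_k}) (\prod_i pX q (x i)) * F x.
Proof.
by rewrite -(iid_vec (h := fun i => (i, j)) _ _ pX_sum1) // => ? ? [].
Qed.

Lemma iid_row2 m n (i i0 : 'I_m) (F : {ffun 'I_n -> 'I_k} -> {ffun 'I_n -> 'I_k} -> R) :
  i != i0 ->
  \sum_(X : 'M['I_k]_(m, n)) iid_pmf q X * F (row_of X i) (row_of X i0) =
  \sum_(x : {ffun 'I_n -> 'I_k}) \sum_(x0 : {ffun 'I_n -> 'I_k})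
    (\prod_j pX q (x j)) * (\prod_j pX q (x0 j)) * F x x0.
Proof.
move=> ne.
rewrite -(marginal2_mx (m := m) (h1 := fun j => (i, j)) (h2 := fun j => (i0, j))
  (c := fun _ _ x => pX q x) F) //; try by move=> ? ? [].
- by move=> j j'; apply: contra ne => /eqP [->].
- by move=> _ _; apply: pX_sum1.
Qed.

Lemma iid_column2 m n (j j0 : 'I_n) (F : {ffun 'I_m -> 'I_k} -> {ffun 'I_m -> 'I_k} -> R) :
  j != j0 ->
  \sum_(X : 'M['I_k]_(m, n)) iid_pmf q X * F (column_of X j) (column_of X j0) =
  \sum_(x : {ffun 'I_m -> 'I_k}) \sum_(x0 : {ffun 'I_m -> 'I_k})
    (\prod_i pX q (x i)) * (\prod_i pX q (x0 i)) * F x x0.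
Proof.
move=> ne.
rewrite -(marginal2_mx (n := n) (h1 := fun i => (i, j)) (h2 := fun i => (i, j0))
  (c := fun _ _ x => pX q x) F) //; try by move=> ? ? [].
- by move=> i i'; apply: contra ne => /eqP [_ ->].
- by move=> _ _; apply: pX_sum1.
Qed.

Lemma noisy_row m n (S : {ffun 'I_n -> 'I_smax.+1}) (sigma : 'S_m) (X : 'M['I_k]_(m, n))
    (i : 'I_m) (F : {ffun 'I_(ncols S) -> 'I_k} -> R) :
  \sum_(Y : 'M['I_k]_(m, ncols S)) noisy_pmf q sigma X Y * F (row_of Y (sigma i)) =
  \sum_(y : {ffun 'I_(ncols S) -> 'I_k})
    (\prod_c chan q (row_of X i (col_of c)) (y c)) * F y.
Proof.
under eq_bigr do rewrite noisy_pmfE.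
pose c i' (d : 'I_(ncols S)) := chan q (X ((sigma^-1)%g i') (col_of d)) : 'I_k -> R.
transitivity (\sum_(Y : 'M['I_k]_(m, ncols S)) (\prod_i' \prod_d c i' d (Y i' d)) *
    F [ffun d => Y (sigma i, d).1 (sigma i, d).2]).
  by [].
rewrite (marginal_mx (h := fun d => (sigma i, d))); last 2 first.
- by move=> ? ? [].
- by move=> *; apply: chan_sum1.
by apply: eq_bigr => y _; congr (_ * _); apply: eq_bigr => d _; rewrite /c /= permK ffunE.
Qed.

Lemma noisy_column m n (S : {ffun 'I_n -> 'I_smax.+1}) (X : 'M['I_k]_(m, n))
    (d : 'I_(ncols S)) (F : {ffun 'I_m -> 'I_k} -> R) :
  \sum_(Y : 'M['I_k]_(m, ncols S)) noisy_pmf q 1%g X Y * F (column_of Y d) =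
  \sum_(y : {ffun 'I_m -> 'I_k}) (\prod_i chan q (column_of X (col_of d) i) (y i)) * F y.
Proof.
under eq_bigr do rewrite noisy_pmfE.
pose c i' (d : 'I_(ncols S)) := chan q (X (((1 : 'S_m)^-1)%g i') (col_of d)) : 'I_k -> R.
transitivity (\sum_(Y : 'M['I_k]_(m, ncols S)) (\prod_i' \prod_d c i' d (Y i' d)) *
    F [ffun i => Y (i, d).1 (i, d).2]).
  by [].
rewrite (marginal_mx (h := fun i => (i, d))); last 2 first.
- by move=> ? ? [].
- by move=> *; apply: chan_sum1.
by apply: eq_bigr => y _; congr (_ * _); apply: eq_bigr => i _; rewrite /c /= invg1 perm1 ffunE.
Qed.

Lemma block_chan_ge0 x b : 0 <= block_chan q x b.
Proof. by rewrite mulr_ge0 ?pS_ge0 // prodr_ge0 // => t _; apply: chan_ge0. Qed.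

Lemma sum_block (F : block -> R) :
  \sum_b F b = \sum_(s : 'I_smax.+1) \sum_(z : {ffun 'I_s -> 'I_k}) F (Tagged _ z).
Proof.
by rewrite sig_big_dep /=; apply: eq_bigr => -[s z].
Qed.

Lemma sum_chan_prod (I : finType) x : \sum_(z : {ffun I -> 'I_k}) \prod_t chan q x (z t) = 1.
Proof.
rewrite -(bigA_distr_bigA (fun _ y => chan q x y)) /= big1 // => _ _; exact: chan_sum1.
Qed.

Lemma sum_block_chan x : \sum_b block_chan q x b = 1.
Proof.
rewrite sum_block -pS_sum1; apply: eq_bigr => s _.
by rewrite /block_chan /= -mulr_sumr sum_chan_prod mulr1.
Qed.

Lemma block_law_ge0 v : 0 <= block_law q v.
Proof. by rewrite mulr_ge0 ?pX_ge0 ?block_chan_ge0. Qed.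

Lemma marg1_block_law x : marg1 (block_law q) x = pX q x.
Proof. by rewrite /marg1 /block_law /= -mulr_sumr sum_block_chan mulr1. Qed.

Lemma sum_block_law : \sum_v block_law q v = 1.
Proof.
rewrite -pX_sum1 -(eq_bigr _ (fun x _ => marg1_block_law x)) pair_big /=.
by apply: eq_bigr => -[].
Qed.

Definition letter_law (v : 'I_k * 'I_k) : R := pX q v.1 * chan q v.1 v.2.

Lemma letter_law_ge0 v : 0 <= letter_law v.
Proof. by rewrite mulr_ge0 ?pX_ge0 ?chan_ge0. Qed.

Lemma marg1_letter_law x : marg1 letter_law x = pX q x.
Proof. by rewrite /marg1 /letter_law /= -mulr_sumr chan_sum1 mulr1. Qed.

Lemma sum_letter_law : \sum_v letter_law v = 1.
Proof.
rewrite -pX_sum1 -(eq_bigr _ (fun x _ => marg1_letter_law x)) pair_big /=.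
by apply: eq_bigr => -[].
Qed.

(** Expectation, for a fixed permutation, of a function of row [i] of [X] and of the row of [Y] that
    matches row [i0], cut along the true pattern. *)
Definition row_expect m n (sigma : 'S_m) (i i0 : 'I_m)
    (F : {ffun 'I_n -> 'I_k} -> {ffun 'I_n -> block} -> R) : R :=
  \sum_(S : {ffun 'I_n -> 'I_smax.+1}) pattern_pmf q S *
  \sum_(X : 'M['I_k]_(m, n)) iid_pmf q X *
  \sum_(Y : 'M['I_k]_(m, ncols S)) noisy_pmf q sigma X Y *
     F (row_of X i) (blocks S (row_of Y (sigma i0))).

Lemma row_expect_same m n (sigma : 'S_m) (i : 'I_m)
    (F : {ffun 'I_n -> 'I_k} -> {ffun 'I_n -> block} -> R) :
  row_expect sigma i i F =
  \sum_(u : {ffun 'I_n -> 'I_k * block}) (\prod_j block_law q (u j)) * F (fsts u) (snds u).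
Proof.
rewrite /row_expect.
transitivity (\sum_(S : {ffun 'I_n -> 'I_smax.+1}) \sum_(x : {ffun 'I_n -> 'I_k})
   (\prod_j pX q (x j)) * (pattern_pmf q S * (\sum_(y : {ffun 'I_(ncols S) -> 'I_k})
       (\prod_c chan q (x (col_of c)) (y c)) * F x (blocks S y)))).
  apply: eq_bigr => S _.
  rewrite -(iid_row i (fun x => pattern_pmf q S * (\sum_(y : {ffun 'I_(ncols S) -> 'I_k})
       (\prod_c chan q (x (col_of c)) (y c)) * F x (blocks S y)))) mulr_sumr.
  apply: eq_bigr => X _; rewrite mulrCA; congr (_ * (_ * _)).
  exact: (noisy_row sigma X i (fun y => F (row_of X i) (blocks S y))).
rewrite exchange_big /=.
transitivity (\sum_(x : {ffun 'I_n -> 'I_k}) \sum_(b : {ffun 'I_n -> block})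
   (\prod_j block_law q (x j, b j)) * F x b).
  apply: eq_bigr => x _; rewrite -mulr_sumr law_blocks mulr_sumr; apply: eq_bigr => b _.
  by rewrite mulrA -big_split.
rewrite sum_ffun_pair; apply: eq_bigr => u _; congr (_ * _).
by apply: eq_bigr => j _; rewrite !ffunE -surjective_pairing.
Qed.

(** Row [i] of [X] is independent of row [i0] and of the pattern, hence of the blocks produced from
    them. *)
Lemma row_expect_diff m n (sigma : 'S_m) (i i0 : 'I_m)
    (F : {ffun 'I_n -> 'I_k} -> {ffun 'I_n -> block} -> R) : i != i0 ->
  row_expect sigma i i0 F =
  \sum_(u : {ffun 'I_n -> 'I_k * block})
    (\prod_j (pX q (u j).1 * marg2 (block_law q) (u j).2)) * F (fsts u) (snds u).
Proof.
move=> ne; rewrite /row_expect.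
transitivity (\sum_(S : {ffun 'I_n -> 'I_smax.+1}) \sum_(x : {ffun 'I_n -> 'I_k})
   \sum_(x0 : {ffun 'I_n -> 'I_k})
   (\prod_j pX q (x j)) * (\prod_j pX q (x0 j)) *
   (pattern_pmf q S * (\sum_(y : {ffun 'I_(ncols S) -> 'I_k})
       (\prod_c chan q (x0 (col_of c)) (y c)) * F x (blocks S y)))).
  apply: eq_bigr => S _.
  rewrite -(iid_row2 (fun x x0 => pattern_pmf q S * (\sum_(y : {ffun 'I_(ncols S) -> 'I_k})
       (\prod_c chan q (x0 (col_of c)) (y c)) * F x (blocks S y))) ne) mulr_sumr.
  apply: eq_bigr => X _; rewrite mulrCA; congr (_ * (_ * _)).
  exact: (noisy_row sigma X i0 (fun y => F (row_of X i) (blocks S y))).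
rewrite exchange_big /=.
transitivity (\sum_(x : {ffun 'I_n -> 'I_k}) \sum_(b : {ffun 'I_n -> block})
   (\prod_j (pX q (x j) * marg2 (block_law q) (b j))) * F x b); last first.
  rewrite sum_ffun_pair; apply: eq_bigr => u _; congr (_ * _).
  by apply: eq_bigr => j _; rewrite !ffunE.
apply: eq_bigr => x _; rewrite exchange_big /=.
transitivity (\sum_(x0 : {ffun 'I_n -> 'I_k}) \sum_(b : {ffun 'I_n -> block})
   (\prod_j pX q (x j)) * (\prod_j block_law q (x0 j, b j)) * F x b).
  apply: eq_bigr => x0 _; rewrite -mulr_sumr law_blocks mulr_sumr; apply: eq_bigr => b _.
  by rewrite !mulrA -[X in X * F x b]mulrA -big_split.
rewrite exchange_big; apply: eq_bigr => b _ /=.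
rewrite -mulr_suml -mulr_sumr big_split /=; congr (_ * _ * _).
by rewrite -(bigA_distr_bigA (fun j x0 => block_law q (x0, b j))).
Qed.

(** * Laws of seed columns for a fixed pattern *)

Definition seed_expect L n (S : {ffun 'I_n -> 'I_smax.+1})
    (F : 'M['I_k]_(L, n) -> 'M['I_k]_(L, ncols S) -> R) : R :=
  \sum_(G1 : 'M['I_k]_(L, n)) iid_pmf q G1 *
  \sum_(G2 : 'M['I_k]_(L, ncols S)) noisy_pmf q 1%g G1 G2 * F G1 G2.

Lemma seed_expect_same L n (S : {ffun 'I_n -> 'I_smax.+1}) (c : 'I_(ncols S))
    (F : {ffun 'I_L -> 'I_k} -> {ffun 'I_L -> 'I_k} -> R) :
  seed_expect (fun G1 G2 => F (column_of G1 (col_of c)) (column_of G2 c)) =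
  \sum_(u : {ffun 'I_L -> 'I_k * 'I_k}) (\prod_l letter_law (u l)) * F (fsts u) (snds u).
Proof.
rewrite /seed_expect.
under eq_bigr => G1 _ do rewrite (noisy_column G1 c (F (column_of G1 (col_of c)))).
rewrite (iid_column (col_of c) (fun x => \sum_(y : {ffun 'I_L -> 'I_k})
  (\prod_l chan q (x l) (y l)) * F x y)).
transitivity (\sum_(x : {ffun 'I_L -> 'I_k}) \sum_(y : {ffun 'I_L -> 'I_k})
  (\prod_l letter_law (x l, y l)) * F x y).
  apply: eq_bigr => x _; rewrite mulr_sumr; apply: eq_bigr => y _.
  by rewrite mulrA -big_split.
rewrite sum_ffun_pair; apply: eq_bigr => u _; congr (_ * _).
by apply: eq_bigr => j _; rewrite !ffunE -surjective_pairing.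
Qed.

Lemma seed_expect_diff L n (S : {ffun 'I_n -> 'I_smax.+1}) j (c : 'I_(ncols S))
    (F : {ffun 'I_L -> 'I_k} -> {ffun 'I_L -> 'I_k} -> R) : j != col_of c ->
  seed_expect (fun G1 G2 => F (column_of G1 j) (column_of G2 c)) =
  \sum_(u : {ffun 'I_L -> 'I_k * 'I_k})
     (\prod_l (pX q (u l).1 * marg2 letter_law (u l).2)) * F (fsts u) (snds u).
Proof.
move=> ne; rewrite /seed_expect.
under eq_bigr => G1 _ do rewrite (noisy_column G1 c (F (column_of G1 j))).
rewrite (iid_column2 (fun x x0 => \sum_(y : {ffun 'I_L -> 'I_k})
  (\prod_l chan q (x0 l) (y l)) * F x y) ne).
transitivity (\sum_(x : {ffun 'I_L -> 'I_k}) \sum_(y : {ffun 'I_L -> 'I_k})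
   (\prod_j (pX q (x j) * marg2 letter_law (y j))) * F x y); last first.
  rewrite sum_ffun_pair; apply: eq_bigr => u _; congr (_ * _).
  by apply: eq_bigr => l _; rewrite !ffunE.
apply: eq_bigr => x _.
transitivity (\sum_(x0 : {ffun 'I_L -> 'I_k}) \sum_(y : {ffun 'I_L -> 'I_k})
   (\prod_j pX q (x j)) * (\prod_j letter_law (x0 j, y j)) * F x y).
  apply: eq_bigr => x0 _; rewrite mulr_sumr; apply: eq_bigr => y _.
  by rewrite !mulrA -[X in X * F x y]mulrA -big_split.
rewrite exchange_big; apply: eq_bigr => b _ /=.
rewrite -mulr_suml -mulr_sumr big_split /=; congr (_ * _ * _).
by rewrite -(bigA_distr_bigA (fun j x0 => letter_law (x0, b j))).
Qed.

(** A block carries [S], which is independent of [X], so the information between a letter and its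
    block is the conditional one: the factors [pS q s] cancel inside the logarithm. Division by
    [ln 2] turns nats into bits. *)
Lemma cond_mutual_infoE : (forall s, 0 < pS q s) ->
  cond_mutual_info q = mutual_nats (block_law q) / ln 2.
Proof.
move=> pS0; rewrite /mutual_nats /cond_mutual_info mulr_suml.
transitivity (\sum_x \sum_b block_law q (x, b) * info_density (block_law q) (x, b) / ln 2);
  last by rewrite pair_big; apply: eq_bigr => -[].
under [RHS]eq_bigr do rewrite sum_block.
rewrite exchange_big /=; apply: eq_bigr => s _.
rewrite mulr_sumr; apply: eq_bigr => x _.
rewrite mulr_sumr; apply: eq_bigr => z _ /=.
rewrite /block_law /block_chan /=.
rewrite -!mulrA mulrCA; congr (_ * (_ * (_ * _))).
rewrite /log2; congr (ln _ / _).
rewrite marg1_block_law /marg2 /block_law /block_chan /=.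
rewrite -mulr_sumr sum_chan_prod mulr1.
under [X in _ = _ / (_ * X)]eq_bigr do rewrite mulrCA.
rewrite -mulr_sumr [X in _ = X / _]mulrCA [X in _ = _ / X]mulrCA.
by rewrite -mulf_div divff ?gt_eqF // mul1r mulrA.
Qed.

End DatabaseLaw.

(** * Expectations under the model *)

Section Expectation.
Variables (R : realType) (k' smax : nat).
Notation k := k'.+1.
Variable q : source R k smax.
Variables n m L : nat.

Definition outcome_fun := forall S : {ffun 'I_n -> 'I_smax.+1},
  'M['I_k]_(m, n) -> 'S_m -> 'M['I_k]_(m, ncols S) ->
  'M['I_k]_(L, n) -> 'M['I_k]_(L, ncols S) -> R.

(* [kap] is the conditional law of [Y]; the model is obtained for
   [kap := noisy_pmf q], and the converse compares it with a law of [Y] not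
   depending on the permutation. *)
Definition expect_with
    (kap : forall S : {ffun 'I_n -> 'I_smax.+1},
       'S_m -> 'M['I_k]_(m, n) -> 'M['I_k]_(m, ncols S) -> R)
    (F : outcome_fun) : R :=
  \sum_(S : {ffun 'I_n -> 'I_smax.+1}) pattern_pmf q S *
  \sum_(X : 'M['I_k]_(m, n)) iid_pmf q X *
  \sum_(sigma : 'S_m) (m`!)%:R^-1 *
  \sum_(Y : 'M['I_k]_(m, ncols S)) kap S sigma X Y *
  \sum_(G1 : 'M['I_k]_(L, n)) iid_pmf q G1 *
  \sum_(G2 : 'M['I_k]_(L, ncols S)) noisy_pmf q 1%g G1 G2 *
    F S X sigma Y G1 G2.

Notation expect := (expect_with (fun S sigma X Y => noisy_pmf q sigma X Y)).

Lemma error_probE (psi : scheme k smax) :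
  error_prob q psi n m L =
  expect (fun S X sigma Y G1 G2 =>
    m%:R^-1 * \sum_i (psi n m L (ncols S) X Y G1 G2 i != Some (sigma i))%:R).
Proof.
rewrite /error_prob /expect_with; apply: eq_bigr => S _.
rewrite mulr_sumr; apply: eq_bigr => X _.
rewrite mulrA mulr_sumr; apply: eq_bigr => sigma _.
rewrite mulrA mulr_sumr; apply: eq_bigr => Y _.
rewrite mulrA mulr_sumr; apply: eq_bigr => G1 _.
rewrite mulrA mulr_sumr; apply: eq_bigr => G2 _.
rewrite !mulrA mulr_sumr big_mkcond /=; apply: eq_bigr => i _.
by case: (_ != _); rewrite ?mulr1 ?mulr0.
Qed.

Lemma fact_inv_ge0 : 0 <= (m`!)%:R^-1 :> R. Proof. by rewrite invr_ge0. Qed.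

Lemma sum_perm_inv : \sum_(sigma : 'S_m) (m`!)%:R^-1 = 1 :> R.
Proof.
rewrite sumr_const (_ : #|_| = m`!); last by rewrite -(card_Sn m); apply: eq_card.
by rewrite -[LHS]mulr_natr mulVf // pnatr_eq0 -lt0n fact_gt0.
Qed.

(** The comparison bears on the products of kernel and integrand, so that it also serves for
    changing the law of [Y]. *)
Lemma expect_with_le kap kap' F F' :
  (forall S sigma X Y G1 G2,
     kap S sigma X Y * F S X sigma Y G1 G2 <= kap' S sigma X Y * F' S X sigma Y G1 G2) ->
  expect_with kap F <= expect_with kap' F'.
Proof.
move=> le_FF'.
apply: ler_sum => S _; rewrite ler_wpM2l ?pattern_pmf_ge0 //.
apply: ler_sum => X _; rewrite ler_wpM2l ?iid_pmf_ge0 //.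
apply: ler_sum => sigma _; rewrite ler_wpM2l ?fact_inv_ge0 //.
apply: ler_sum => Y _; rewrite !mulr_sumr.
apply: ler_sum => G1 _; rewrite mulrCA [leRHS]mulrCA ler_wpM2l ?iid_pmf_ge0 // !mulr_sumr.
apply: ler_sum => G2 _; rewrite mulrCA [leRHS]mulrCA ler_wpM2l ?noisy_pmf_ge0 //.
Qed.

Lemma expect_le (F F' : outcome_fun) :
  (forall S X sigma Y G1 G2, F S X sigma Y G1 G2 <= F' S X sigma Y G1 G2) ->
  expect F <= expect F'.
Proof.
by move=> le_FF'; apply: expect_with_le => *; rewrite ler_wpM2l ?noisy_pmf_ge0.
Qed.

Lemma expect_withD kap (F F' : outcome_fun) :
  expect_with kap (fun S X sigma Y G1 G2 => F S X sigma Y G1 G2 + F' S X sigma Y G1 G2) =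
  expect_with kap F + expect_with kap F'.
Proof.
rewrite /expect_with -big_split; apply: eq_bigr => S _ /=; rewrite -mulrDr; congr (_ * _).
rewrite -big_split; apply: eq_bigr => X _ /=; rewrite -mulrDr; congr (_ * _).
rewrite -big_split; apply: eq_bigr => sigma _ /=; rewrite -mulrDr; congr (_ * _).
rewrite -big_split; apply: eq_bigr => Y _ /=; rewrite -mulrDr; congr (_ * _).
rewrite -big_split; apply: eq_bigr => G1 _ /=; rewrite -mulrDr; congr (_ * _).
rewrite -big_split; apply: eq_bigr => G2 _ /=; by rewrite -mulrDr.
Qed.

Lemma expect_withZ kap (a : R) (F : outcome_fun) :
  expect_with kap (fun S X sigma Y G1 G2 => a * F S X sigma Y G1 G2) =
  a * expect_with kap F.
Proof.
rewrite /expect_with mulr_sumr; apply: eq_bigr => S _ /=; rewrite mulrCA; congr (_ * _).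
rewrite mulr_sumr; apply: eq_bigr => X _ /=; rewrite mulrCA; congr (_ * _).
rewrite mulr_sumr; apply: eq_bigr => sigma _ /=; rewrite mulrCA; congr (_ * _).
rewrite mulr_sumr; apply: eq_bigr => Y _ /=; rewrite mulrCA; congr (_ * _).
rewrite mulr_sumr; apply: eq_bigr => G1 _ /=; rewrite mulrCA; congr (_ * _).
rewrite mulr_sumr; apply: eq_bigr => G2 _ /=; by rewrite mulrCA.
Qed.

Lemma expect_with_sum kap (I : finType) (F : I -> outcome_fun) :
  expect_with kap (fun S X sigma Y G1 G2 => \sum_i F i S X sigma Y G1 G2) =
  \sum_i expect_with kap (F i).
Proof.
rewrite /expect_with exchange_big; apply: eq_bigr => S _ /=; rewrite -[RHS]mulr_sumr; congr (_ * _).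
rewrite exchange_big; apply: eq_bigr => X _ /=; rewrite -[RHS]mulr_sumr; congr (_ * _).
rewrite exchange_big; apply: eq_bigr => sigma _ /=; rewrite -[RHS]mulr_sumr; congr (_ * _).
rewrite exchange_big; apply: eq_bigr => Y _ /=; rewrite -[RHS]mulr_sumr; congr (_ * _).
rewrite exchange_big; apply: eq_bigr => G1 _ /=; rewrite -[RHS]mulr_sumr; congr (_ * _).
rewrite exchange_big; apply: eq_bigr => G2 _ /=; by rewrite -[RHS]mulr_sumr.
Qed.

Lemma sum_seeds (S : {ffun 'I_n -> 'I_smax.+1}) (a : R) :
  \sum_(G1 : 'M['I_k]_(L, n)) iid_pmf q G1 *
  (\sum_(G2 : 'M['I_k]_(L, ncols S)) noisy_pmf q 1%g G1 G2 * a) = a.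
Proof.
under eq_bigr do rewrite -mulr_suml sum_noisy mul1r.
by rewrite -mulr_suml sum_iid mul1r.
Qed.

Lemma expect_seeds (F : forall S : {ffun 'I_n -> 'I_smax.+1},
    'M['I_k]_(L, n) -> 'M['I_k]_(L, ncols S) -> R) :
  expect (fun S _ _ _ G1 G2 => F S G1 G2) =
  \sum_(S : {ffun 'I_n -> 'I_smax.+1}) pattern_pmf q S * seed_expect q (F S).
Proof.
apply: eq_bigr => S _; congr (_ * _); rewrite -/(seed_expect q (F S)).
under eq_bigr do under eq_bigr do rewrite -mulr_suml sum_noisy mul1r.
under eq_bigr do rewrite -mulr_suml sum_perm_inv mul1r.
by rewrite -mulr_suml sum_iid mul1r.
Qed.

Lemma expect_db (F : forall S : {ffun 'I_n -> 'I_smax.+1},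
    'M['I_k]_(m, n) -> 'S_m -> 'M['I_k]_(m, ncols S) -> R) :
  expect (fun S X sigma Y _ _ => F S X sigma Y) =
  \sum_(sigma : 'S_m) (m`!)%:R^-1 *
    \sum_(S : {ffun 'I_n -> 'I_smax.+1}) pattern_pmf q S *
    \sum_(X : 'M['I_k]_(m, n)) iid_pmf q X *
    \sum_(Y : 'M['I_k]_(m, ncols S)) noisy_pmf q sigma X Y * F S X sigma Y.
Proof.
rewrite /expect_with.
under [RHS]eq_bigr do rewrite mulr_sumr.
rewrite [RHS]exchange_big; apply: eq_bigr => S _ /=.
under [RHS]eq_bigr do rewrite mulrCA mulr_sumr.
rewrite -[RHS]mulr_sumr; congr (_ * _).
rewrite [RHS]exchange_big; apply: eq_bigr => X _ /=.
under [RHS]eq_bigr do rewrite mulrCA.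
rewrite -[RHS]mulr_sumr; congr (_ * _).
apply: eq_bigr => sigma _; congr (_ * _).
by apply: eq_bigr => Y _; rewrite sum_seeds.
Qed.

Lemma expect_row (i : 'I_m) (r : 'S_m -> 'I_m)
    (F : {ffun 'I_n -> 'I_k} -> {ffun 'I_n -> {s : 'I_smax.+1 & {ffun 'I_s -> 'I_k}}} -> R) :
  expect (fun S X sigma Y _ _ => F (row_of X i) (blocks S (row_of Y (sigma (r sigma))))) =
  \sum_(sigma : 'S_m) (m`!)%:R^-1 * row_expect q sigma i (r sigma) F.
Proof. by rewrite expect_db. Qed.

Lemma sum_perm_le (a b : R) : a <= b -> \sum_(sigma : 'S_m) (m`!)%:R^-1 * a <= b.
Proof. by move=> le_ab; rewrite -mulr_suml sum_perm_inv mul1r. Qed.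

(** When the law of [Y] ignores the permutation, [sigma] remains uniform given all that the scheme
    observes and can be averaged first. *)
Lemma expect_with_swap (kap : forall S : {ffun 'I_n -> 'I_smax.+1},
       'M['I_k]_(m, n) -> 'M['I_k]_(m, ncols S) -> R) (F : outcome_fun) :
  expect_with (fun S _ X Y => kap S X Y) F =
  \sum_(S : {ffun 'I_n -> 'I_smax.+1}) pattern_pmf q S *
  \sum_(X : 'M['I_k]_(m, n)) iid_pmf q X *
  \sum_(Y : 'M['I_k]_(m, ncols S)) kap S X Y *
  \sum_(G1 : 'M['I_k]_(L, n)) iid_pmf q G1 *
  \sum_(G2 : 'M['I_k]_(L, ncols S)) noisy_pmf q 1%g G1 G2 *
  \sum_(sigma : 'S_m) (m`!)%:R^-1 * F S X sigma Y G1 G2.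
Proof.
apply: eq_bigr => S _; congr (_ * _); apply: eq_bigr => X _; congr (_ * _).
under eq_bigr do rewrite mulr_sumr.
rewrite exchange_big; apply: eq_bigr => Y _ /=.
under eq_bigr do rewrite mulrCA mulr_sumr.
rewrite -[LHS]mulr_sumr; congr (_ * _).
rewrite exchange_big; apply: eq_bigr => G1 _ /=.
under eq_bigr do rewrite mulrCA mulr_sumr.
rewrite -[LHS]mulr_sumr; congr (_ * _).
rewrite exchange_big; apply: eq_bigr => G2 _ /=.
under eq_bigr do rewrite mulrCA.
by rewrite -[LHS]mulr_sumr.
Qed.

Lemma expect_const a : expect (fun _ _ _ _ _ _ => a) = a.
Proof.
rewrite (expect_seeds (fun _ _ _ => a)).
under eq_bigr do rewrite /seed_expect sum_seeds.
by rewrite -mulr_suml sum_pattern mul1r.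
Qed.

End Expectation.

(** * Converse *)

Section Converse.
Variables (R : realType) (k' smax : nat).
Notation k := k'.+1.
Notation block := {s : 'I_smax.+1 & {ffun 'I_s -> 'I_k}}.
Variable q : source R k smax.
Hypothesis pX_gt0 : forall x, 0 < pX q x.
Hypothesis pS_gt0 : forall s, 0 < pS q s.

(** Expanding the right side gives one nonnegative term for each map from rows to columns; the
    permanent keeps the injective maps only. *)
Lemma permanent_le (m : nat) (B : 'I_m -> 'I_m -> R) :
  (forall i j, 0 <= B i j) ->
  \sum_(sigma : 'S_m) \prod_i B i (sigma i) <= \prod_i \sum_j B i j.
Proof.
move=> B0; rewrite bigA_distr_bigA /=.
rewrite [leRHS](bigID (fun f : {ffun 'I_m -> 'I_m} => injectiveb f)) /=.
rewrite ler_wpDr ?sumr_ge0 // => [f _|]; first exact: prodr_ge0.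
rewrite le_eqVlt; apply/orP; left; apply/eqP.
rewrite (reindex_onto (fun s : 'S_m => pval s) (fun f => insubd (1%g : 'S_m) f)) /=; last first.
  by move=> f f_inj; apply: (insubdK (1%g : 'S_m)).
apply: eq_big => [s|s _].
  by rewrite (valP s) /= -[pval s]/(val s) valKd eqxx.
by apply: eq_bigr => i _; rewrite pvalE.
Qed.

(** [m ^ m / m!] is one term of the exponential series at [m]. *)
Lemma expn_le_fact (m : nat) : (m ^ m)%N%:R <= expR 1 ^+ m * (m`!)%:R :> R.
Proof.
rewrite -expRM_natl mulr1.
case: m => [|m]; first by rewrite expR0 mul1r.
have := @expR_ge1Dxn R m.+1%:R m (ler0n _ _) => h.
rewrite -ler_pdivrMr ?ltr0n ?fact_gt0 //.
by apply: le_trans h; rewrite natrX lerDr ler01.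
Qed.

(** The power of [m] is a product over rows of entries [m] (correct guess) or 1, so the sum is a
    permanent divided by [m!]. Each row of the matrix sums to at most [2 * m], and
    [m ^ m <= e ^ m * m!] concludes. *)
Lemma correct_moment (m : nat) (hat : 'I_m -> option 'I_m) : (0 < m)%N ->
  \sum_(sigma : 'S_m) (m`!)%:R^-1 * m%:R ^+ (\sum_i (hat i == Some (sigma i))) <=
  (2 * expR 1) ^+ m :> R.
Proof.
move=> m0.
pose B (i j : 'I_m) : R := if hat i == Some j then m%:R else 1.
have B0 i j : 0 <= B i j by rewrite /B; case: ifP.
have rowB i : \sum_j B i j <= 2 * m%:R.
  apply: le_trans (_ : \sum_j (1 + (if hat i == Some j then m%:R else 0)) <= _).
    by apply: ler_sum => j _; rewrite /B; case: ifP => _; rewrite ?addr0 // lerDr.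
  rewrite big_split /= sumr_const card_ord mulr2n mulrDl !mul1r lerD2l.
  rewrite -big_mkcond /=; case: (hat i) => [j|]; last by rewrite big_pred0.
  by rewrite (big_pred1 j) // => j'; rewrite eq_sym.
rewrite -mulr_sumr ler_pdivrMl ?ltr0n ?fact_gt0 //.
apply: le_trans (_ : \sum_(sigma : 'S_m) \prod_i B i (sigma i) <= _).
  apply: ler_sum => sigma _; rewrite -prodrXr; apply: ler_prod => i _.
  by rewrite exprn_ge0 //= /B; case: (_ == _); rewrite ?expr1 ?expr0.
apply: le_trans (permanent_le B0) _.
apply: le_trans (_ : \prod_(i < m) (2 * m%:R) <= _).
  by apply: ler_prod => i _; rewrite sumr_ge0 //=.
rewrite prodr_const card_ord !exprMn mulrCA ler_wpM2l ?exprn_ge0 //.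
by rewrite -natrX mulrC; apply: expn_le_fact.
Qed.

(** * The law of [Y] that ignores the permutation, and the likelihood ratio to it *)

Definition copies_law (s : 'I_smax.+1) (z : {ffun 'I_s -> 'I_k}) : R :=
  \sum_x pX q x * \prod_t chan q x (z t).

Definition unmatched_pmf m n (S : {ffun 'I_n -> 'I_smax.+1}) (Y : 'M['I_k]_(m, ncols S)) : R :=
  \prod_i \prod_j copies_law [ffun t => Y i (@copy_col n smax S j t)].

Lemma unmatched_pmfE m n (S : {ffun 'I_n -> 'I_smax.+1}) (Y : 'M['I_k]_(m, ncols S)) :
  unmatched_pmf Y = \sum_(X : 'M['I_k]_(m, n)) iid_pmf q X * noisy_pmf q 1%g X Y.
Proof.
rewrite sum_mx /unmatched_pmf pair_big /=.
rewrite /copies_law (bigA_distr_bigA (fun (p : 'I_m * 'I_n) x => pX q x *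
  \prod_t chan q x ([ffun t => Y p.1 (@copy_col n smax S p.2 t)] t))) /=.
apply: eq_bigr => f _; rewrite /iid_pmf /noisy_pmf !pair_big -big_split /=.
apply: eq_bigr => -[i j] _ /=; rewrite !mxE; congr (_ * _).
by apply: eq_bigr => t _; rewrite ffunE perm1.
Qed.

Lemma sum_unmatched m n (S : {ffun 'I_n -> 'I_smax.+1}) :
  \sum_(Y : 'M['I_k]_(m, ncols S)) unmatched_pmf Y = 1.
Proof.
under eq_bigr do rewrite unmatched_pmfE.
rewrite exchange_big /=.
by under eq_bigr do rewrite -mulr_sumr sum_noisy mulr1; rewrite sum_iid.
Qed.

Lemma copies_law_ge0 (s : 'I_smax.+1) (z : {ffun 'I_s -> 'I_k}) : 0 <= copies_law z.
Proof.
by apply: sumr_ge0 => x _; rewrite mulr_ge0 ?pX_ge0 ?prodr_ge0 // => t _; apply: chan_ge0.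
Qed.

Lemma unmatched_pmf_ge0 m n (S : {ffun 'I_n -> 'I_smax.+1}) (Y : 'M['I_k]_(m, ncols S)) :
  0 <= unmatched_pmf Y.
Proof. by do 2![apply: prodr_ge0 => ? _]; apply: copies_law_ge0. Qed.

Lemma expR_info_density x (s : 'I_smax.+1) (z : {ffun 'I_s -> 'I_k}) :
  0 < \prod_t chan q x (z t) ->
  expR (- info_density (block_law q) (x, Tagged (fun s : 'I_smax.+1 => {ffun 'I_s -> 'I_k}) z)) =
  copies_law z / \prod_t chan q x (z t).
Proof.
move=> c0; rewrite /info_density marg1_block_law /=.
have -> : marg2 (block_law q) (Tagged (fun s : 'I_smax.+1 => {ffun 'I_s -> 'I_k}) z) =
    pS q s * copies_law z.
  by rewrite mulr_sumr; apply: eq_bigr => x' _; rewrite /block_law /block_chan /= mulrCA.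
have z0 : 0 < copies_law z.
  rewrite /copies_law (bigD1 x) //= ltr_wpDr ?mulr_gt0 //.
  by apply: sumr_ge0 => x' _; rewrite mulr_ge0 ?pX_ge0 ?prodr_ge0 // => t _; apply: chan_ge0.
rewrite expRN lnK ?posrE /block_law /block_chan /=; last by rewrite !(divr_gt0, mulr_gt0).
have := pX_gt0 x; have := pS_gt0 s; move: (pX q x) (pS q s) (\prod_t _) (copies_law z) c0 z0.
by move=> a b c d c0 d0 b0 a0; field; rewrite !gt_eqF.
Qed.

(** The logarithm of [noisy_pmf] over [unmatched_pmf] wherever [noisy_pmf] is positive. *)
Definition total_info m n (S : {ffun 'I_n -> 'I_smax.+1}) (X : 'M['I_k]_(m, n))
    (sigma : 'S_m) (Y : 'M['I_k]_(m, ncols S)) : R :=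
  \sum_i \sum_j info_density (block_law q) (row_of X i j, blocks S (row_of Y (sigma i)) j).

(** Equality holds where [noisy_pmf] is positive. Elsewhere [total_info] involves logarithms of 0
    and only the inequality, with left side 0, remains. *)
Lemma noisy_expR_total_info m n (S : {ffun 'I_n -> 'I_smax.+1}) (X : 'M['I_k]_(m, n))
    (sigma : 'S_m) (Y : 'M['I_k]_(m, ncols S)) :
  noisy_pmf q sigma X Y * expR (- total_info X sigma Y) <= unmatched_pmf Y.
Proof.
have [->|] := eqVneq (noisy_pmf q sigma X Y) 0; first by rewrite mul0r unmatched_pmf_ge0.
move/prodf_neq0 => nz.
have cpos i j : 0 < \prod_t chan q (X i j) (Y (sigma i) (@copy_col n smax S j t)).
  rewrite lt_def prodr_ge0 => [|t _]; last exact: chan_ge0.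
  by rewrite andbT; move/prodf_neq0: (nz i isT); apply.
rewrite le_eqVlt; apply/orP; left; apply/eqP.
rewrite /total_info -sumrN expR_sum /unmatched_pmf [RHS](reindex_inj (@perm_inj _ sigma)) /=.
rewrite /noisy_pmf -big_split /=; apply: eq_bigr => i _.
rewrite -sumrN expR_sum -big_split /=; apply: eq_bigr => j _.
rewrite blocksE !ffunE.
have zE : [ffun t => row_of Y (sigma i) (@copy_col n smax S j t)] =
    [ffun t => Y (sigma i) (@copy_col n smax S j t)] :> {ffun 'I_(S j) -> 'I_k}.
  by apply/ffunP => t; rewrite !ffunE.
rewrite zE.
have cE : \prod_t chan q (X i j) ([ffun t => Y (sigma i) (@copy_col n smax S j t)] t) =
     \prod_t chan q (X i j) (Y (sigma i) (@copy_col n smax S j t)).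
  by apply: eq_bigr => t _; rewrite ffunE.
rewrite expR_info_density cE // mulrC divfK // gt_eqF //; exact: cpos.
Qed.

Lemma expect_total_info n m L :
  expect_with q (fun S sigma X Y => noisy_pmf q sigma X Y)
    (fun (S : {ffun 'I_n -> 'I_smax.+1}) (X : 'M['I_k]_(m, n)) sigma Y
       (_ : 'M['I_k]_(L, n)) (_ : 'M['I_k]_(L, ncols S)) => total_info X sigma Y) =
  m%:R * n%:R * mutual_nats (block_law q).
Proof.
rewrite expect_with_sum.
rewrite (eq_bigr (fun=> n%:R * mutual_nats (block_law q))).
  by rewrite sumr_const card_ord -[LHS]mulr_natl mulrA.
move=> i _; pose f := info_density (block_law q).
rewrite (expect_row q L i (fun=> i) (fun x b => \sum_j f (x j, b j))).
transitivity (\sum_(sigma : 'S_m) (m`!)%:R^-1 * (n%:R * mutual_nats (block_law q))); last first.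
  by rewrite -mulr_suml sum_perm_inv mul1r.
apply: eq_bigr => sigma _; congr (_ * _).
rewrite row_expect_same; under eq_bigr do rewrite mulr_sumr.
rewrite exchange_big /= (eq_bigr (fun=> mutual_nats (block_law q))).
  by rewrite sumr_const card_ord -[LHS]mulr_natl.
move=> j _.
(* A family indexed by one point extracts the marginal of coordinate [j]. *)
have h_inj : injective (fun _ : 'I_1 => j) by move=> a b _; rewrite !ord1.
have := marginal_prod (fun z : {ffun 'I_1 -> 'I_k * block} => f (z ord0)) h_inj
  (c := fun _ => block_law q) (fun _ => sum_block_law q).
move=> fE; transitivity (\sum_(y : {ffun 'I_n -> 'I_k * block})
    (\prod_i block_law q (y i)) * f ([ffun _ : 'I_1 => y j] ord0)).
  by apply: eq_bigr => u _; rewrite !ffunE -surjective_pairing.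
rewrite fE /mutual_nats (reindex (fun v => [ffun _ : 'I_1 => v])) /=; last first.
  exists (fun z : {ffun 'I_1 -> 'I_k * block} => z ord0) => [v _|z _]; first by rewrite ffunE.
  by apply/ffunP => a; rewrite ffunE (ord1 a).
by apply: eq_bigr => v _; rewrite big_ord1 !ffunE.
Qed.

(* Change of measure: with [g] the number of correctly matched rows times
   [ln m], the moment [correct_moment] under the law in which [Y] ignores
   [sigma] bounds the expectation of [g] under the model. *)
Lemma error_prob_converse (psi : scheme k smax) n m L : (0 < m)%N ->
  (1 - error_prob q psi n m L) * ln m%:R <=
  n%:R * mutual_nats (block_law q) + ln (2 * expR 1).
Proof.
move=> m0; have mR : 0 < m%:R :> R by rewrite ltr0n.
pose corr S X (sigma : 'S_m) Y G1 G2 : nat :=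
  (\sum_i (psi n m L (@ncols n smax S) X Y G1 G2 i == Some (sigma i)))%N.
(* Normalization: [expR z] is the bound of [correct_moment], so [Eu] compares with 1. *)
pose z : R := m%:R * ln (2 * expR 1).
pose kap := fun S sigma (X : 'M['I_k]_(m, n)) Y => @noisy_pmf R k smax q m n S sigma X Y.
pose kap' := fun S (sigma : 'S_m) (X : 'M['I_k]_(m, n)) Y => @unmatched_pmf m n S Y.
have EN : expect_with q kap (fun S X sigma Y G1 G2 => (corr S X sigma Y G1 G2)%:R) =
    m%:R * (1 - error_prob q psi n m L).
  rewrite error_probE //.
  pose e : outcome_fun R k' smax n m L := fun S X sigma Y G1 G2 =>
    m%:R^-1 * \sum_i (psi n m L (ncols S) X Y G1 G2 i != Some (sigma i))%:R.
  transitivity (expect_with q kap (fun S X sigma Y G1 G2 =>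
      m%:R + - m%:R * e S X sigma Y G1 G2)).
    congr (expect_with q kap); do 6![apply: functional_extensionality_dep => ?].
    rewrite /e /corr mulNr mulrA divff ?gt_eqF // mul1r. rewrite natr_sum.
    have -> : m%:R = \sum_(i < m) (1 : R) by rewrite sumr_const card_ord.
    rewrite -sumrB.
    by apply: eq_bigr => i _; case: (_ == _); rewrite /= ?subr0 ?subrr.
  by rewrite expect_withD expect_withZ expect_const // mulrBr mulr1 mulNr.
have Eu : expect_with q kap' (fun S X sigma Y G1 G2 => expR ((corr S X sigma Y G1 G2)%:R * ln m%:R - z)) <= 1.
  rewrite /kap' (expect_with_swap q (fun S _ Y => unmatched_pmf Y)).
  rewrite -[leRHS](sum_pattern q n).
  apply: ler_sum => S _; rewrite -[leRHS]mulr1 ler_wpM2l ?pattern_pmf_ge0 //.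
  rewrite -[leRHS](sum_iid q m n).
  apply: ler_sum => X _; rewrite -[leRHS]mulr1 ler_wpM2l ?iid_pmf_ge0 //.
  rewrite -[leRHS](sum_unmatched m S).
  apply: ler_sum => Y _; rewrite -[leRHS]mulr1 ler_wpM2l ?unmatched_pmf_ge0 //.
  rewrite -[leRHS](sum_iid q L n).
  apply: ler_sum => G1 _; rewrite -[leRHS]mulr1 ler_wpM2l ?iid_pmf_ge0 //.
  rewrite -[leRHS](sum_noisy q S 1%g G1).
  apply: ler_sum => G2 _; rewrite -[leRHS]mulr1 ler_wpM2l ?noisy_pmf_ge0 //.
  under eq_bigr do rewrite expRD expRN mulrA.
  rewrite -mulr_suml ler_pdivrMr ?expR_gt0 // mul1r.
  under eq_bigr do rewrite expRM_natl lnK ?posrE //.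
  rewrite expRM_natl lnK ?posrE ?mulr_gt0 ?expR_gt0 //.
  exact: correct_moment.
(* By [1 + u <= expR u], the exponential of minus [total_info] then converts the law [kap] into
   [kap']. Linearity and the value of the mean of [total_info] turn this into the claim. *)
have h : expect_with q kap (fun S X sigma Y G1 G2 =>
     (corr S X sigma Y G1 G2)%:R * ln m%:R - z - total_info X sigma Y + 1) <= 1.
  apply: le_trans Eu; apply: expect_with_le => S sigma X Y G1 G2.
  rewrite /kap /kap' -addrA addrC.
  apply: le_trans (_ : noisy_pmf q sigma X Y * expR (- total_info X sigma Y) *
     expR ((corr S X sigma Y G1 G2)%:R * ln m%:R - z) <= _); last first.
    by rewrite ler_wpM2r ?expR_ge0 // noisy_expR_total_info.
  rewrite -mulrA -expRD ler_wpM2l ?noisy_pmf_ge0 //.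
  apply: le_trans (expR_ge1Dx _); lra.
have : expect_with q kap (fun S X sigma Y G1 G2 =>
     (corr S X sigma Y G1 G2)%:R * ln m%:R - z - total_info X sigma Y + 1) =
  ln m%:R * (m%:R * (1 - error_prob q psi n m L)) - z - m%:R * n%:R * mutual_nats (block_law q) + 1.
  transitivity (expect_with q kap (fun S X sigma Y G1 G2 =>
      ln m%:R * (corr S X sigma Y G1 G2)%:R + (-1 * total_info X sigma Y + (1 - z)))).
    congr (expect_with q kap); do 6![apply: functional_extensionality_dep => ?]; ring.
  rewrite !expect_withD !expect_withZ EN !expect_const expect_total_info.
  ring.
move=> hE; rewrite hE in h.
rewrite -(ler_pM2l mR) mulrDr; rewrite /z in h; lra.
Qed.

End Converse.

(** * The matcher and its error probability *)

Section Matcher.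
Variables (R : realType) (k' smax : nat).
Notation k := k'.+1.
Notation block := {s : 'I_smax.+1 & {ffun 'I_s -> 'I_k}}.

(** The power of [L.+1] cancels the number of types of a pair of seed columns; [n.+1 ^ 4] outweighs
    the union bound over the at most [n * (n * smax)] pairs of columns. *)
Definition column_threshold n L : R := ((n.+1 ^ 4 * L.+1 ^ (k * k))%N)%:R.

Definition detected n L K (G1 : 'M['I_k]_(L, n)) (G2 : 'M['I_k]_(L, K)) j c : bool :=
  column_threshold n L < score R (zips (column_of G1 j) (column_of G2 c)).

Definition estimated_pattern n L K (G1 : 'M['I_k]_(L, n)) (G2 : 'M['I_k]_(L, K)) :
    {ffun 'I_n -> 'I_smax.+1} :=
  [ffun j => inord #|[pred c | detected G1 G2 j c]|].

(** The factor [m] pays for the union bound over rows, the power of [n.+1] for the number of types,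
    with one factor to spare so that the error vanishes. *)
Definition row_threshold n m : R :=
  ((m * n.+1 ^ (#|'I_k| * #|{: block}|).+1)%N)%:R.

Definition matcher : scheme k smax := fun n m L K X Y G1 G2 i =>
  [pick i' | row_threshold n m <
     score R (zips (row_of X i) (blocks (estimated_pattern G1 G2) (row_of Y i')))].

Lemma card_col_of n (S : {ffun 'I_n -> 'I_smax.+1}) j : #|[pred c : 'I_(ncols S) | col_of c == j]| = S j.
Proof.
rewrite -[RHS]card_ord -(card_codom (@copy_col_inj smax n S j)).
apply: eq_card => c; rewrite !inE; apply/eqP/codomP => [<-|[t ->]]; last exact: col_of_copy.
exists (pos_of c); apply: esym.
exact: (@tagnat.sig2K n (fun i => S i : nat)).
Qed.

Lemma estimated_patternE n L (S : {ffun 'I_n -> 'I_smax.+1})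
    (G1 : 'M['I_k]_(L, n)) (G2 : 'M['I_k]_(L, ncols S)) :
  (forall j c, detected G1 G2 j c = (col_of c == j)) -> estimated_pattern G1 G2 = S.
Proof.
move=> detE; apply/ffunP => j; rewrite ffunE.
rewrite (eq_card (B := [pred c : 'I_(ncols S) | col_of c == j])) => [|c]; last by rewrite !inE detE.
by rewrite card_col_of inord_val.
Qed.

Variable q : source R k smax.

(** An error requires a misclassified pair of seed columns, a true match whose score is too low, or
    a wrong row whose score is too high. *)
Lemma matcher_error n m L (S : {ffun 'I_n -> 'I_smax.+1}) X (sigma : 'S_m) Y
    (G1 : 'M['I_k]_(L, n)) (G2 : 'M['I_k]_(L, ncols S)) i :
  (matcher X Y G1 G2 i != Some (sigma i))%:R <=
  \sum_j \sum_c (detected G1 G2 j c != (col_of c == j))%:R +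
  (score R (zips (row_of X i) (blocks S (row_of Y (sigma i)))) <= row_threshold n m)%R%:R +
  \sum_(i' | i' != i)
    (row_threshold n m < score R (zips (row_of X i) (blocks S (row_of Y (sigma i')))))%R%:R :> R.
Proof.
set s1 := (X in _ <= X + _ + _); set s2 := (X in _ <= _ + X + _); set s3 := (X in _ <= _ + X).
have s10 : 0 <= s1 by apply: sumr_ge0 => j _; apply: sumr_ge0.
have s30 : 0 <= s3 by apply: sumr_ge0.
case: eqP => [|/eqP ne] /=; first by rewrite !addr_ge0.
have [/existsP [j /existsP [c bad]]|/existsPn good] :=
    boolP [exists j, exists c, detected G1 G2 j c != (col_of c == j)].
  rewrite -addrA ler_wpDr ?addr_ge0 //.
  rewrite /s1 (bigD1 j) //= (bigD1 c) //= bad -addrA lerDl addr_ge0 ?sumr_ge0 //.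
  by move=> *; apply: sumr_ge0.
have {good} Sest : estimated_pattern G1 G2 = S.
  apply: estimated_patternE => j c; apply/eqP.
  by have /existsPn/(_ c) := good j; rewrite negbK.
move: ne; rewrite /matcher Sest; case: pickP => [i' /= hi' ne|no _]; last first.
  have s21 : s2 = 1 by rewrite /s2 leNgt; have /= -> := no (sigma i).
  by rewrite ler_wpDr // ler_wpDl // s21.
(* The wrong row [i'] that was picked is indexed in the sum by its preimage under [sigma], which
   differs from [i]. *)
rewrite ler_wpDl ?addr_ge0 // /s3 (bigD1 ((sigma^-1)%g i')) /=; last first.
  by apply: contra ne => /eqP <-; rewrite permKV.
by rewrite permKV [X in (nat_of_bool X)%:R + _]hi' lerDl sumr_ge0.
Qed.

Lemma seed_expect_sum L n (S : {ffun 'I_n -> 'I_smax.+1}) (I : finType)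
    (F : I -> 'M['I_k]_(L, n) -> 'M['I_k]_(L, ncols S) -> R) :
  seed_expect q (fun G1 G2 => \sum_i F i G1 G2) = \sum_i seed_expect q (F i).
Proof.
rewrite /seed_expect exchange_big; apply: eq_bigr => G1 _ /=.
rewrite -[RHS]mulr_sumr; congr (_ * _).
by rewrite exchange_big; apply: eq_bigr => G2 _ /=; rewrite -[RHS]mulr_sumr.
Qed.

(** The first term bounds a false alarm, by [score_indep]; the others bound a missed copy, by
    [score_joint]. Their sum covers both cases uniformly. *)
Lemma detection_error n L (S : {ffun 'I_n -> 'I_smax.+1}) j c (v d : R) : 0 < v ->
  \sum_(u : {ffun 'I_L -> 'I_k * 'I_k}) (\prod_l letter_law q (u l)) *
     (\prod_l letter_law q (u l) <= column_threshold n L * v ^+ 2 *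
        \prod_l (marg1 (letter_law q) (u l).1 * marg2 (letter_law q) (u l).2))%R%:R <= d ->
  @seed_expect R k' smax q L n S (fun G1 G2 => (detected G1 G2 j c != (col_of c == j))%:R) <=
  ((L.+1 ^ (k * k))%N)%:R / column_threshold n L + 2 * ((L.+1 ^ k)%N)%:R / v + d.
Proof.
move=> v0 le_d.
have t0 : 0 < column_threshold n L by rewrite ltr0n muln_gt0 !expn_gt0.
have d0 : 0 <= d.
  apply: le_trans le_d; apply: sumr_ge0 => u _.
  by rewrite mulr_ge0 ?prodr_ge0 // => l _; apply: letter_law_ge0.
have [<-|ne] := eqVneq (col_of c) j.
  rewrite (seed_expect_same q c
    (fun x y => ((column_threshold n L < score R (zips x y)) != true)%:R)).
  under eq_bigr do rewrite zips_fsts_snds eqb_id -leNgt.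
  have -> : 2 * ((L.+1 ^ k)%N)%:R / v = ((L.+1 ^ k)%N)%:R / v + ((L.+1 ^ k)%N)%:R / v.
    by rewrite -mulrA mulr_natl mulr2n.
  apply: le_trans (score_joint (letter_law_ge0 q) (sum_letter_law q) _ _ v0) _.
  rewrite !card_ord -[leRHS]addrA ler_wpDl ?divr_ge0 ?(ltW t0) //.
  by rewrite lerD2l.
rewrite (seed_expect_diff q
    (fun x y => ((column_threshold n L < score R (zips x y)) != false)%:R)); last by rewrite eq_sym.
under eq_bigr do rewrite zips_fsts_snds eqbF_neg negbK.
apply: le_trans (score_indep _ _ _ _ _ t0) _.
- exact: pX_ge0.
- by rewrite pX_sum1.
- exact: (marg2_ge0 (letter_law_ge0 q)).
- by rewrite (sum_marg2 (sum_letter_law q)).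
rewrite !card_ord -addrA lerDl addr_ge0 // mulr_ge0 ?invr_ge0 ?(ltW v0) //.
Qed.

Lemma matcher_error_prob n m L (v1 v2 d1 d2 : R) : (0 < m)%N -> 0 < v1 -> 0 < v2 ->
  \sum_(u : {ffun 'I_L -> 'I_k * 'I_k}) (\prod_l letter_law q (u l)) *
     (\prod_l letter_law q (u l) <= column_threshold n L * v1 ^+ 2 *
        \prod_l (marg1 (letter_law q) (u l).1 * marg2 (letter_law q) (u l).2))%R%:R <= d1 ->
  \sum_(u : {ffun 'I_n -> 'I_k * block}) (\prod_j block_law q (u j)) *
     (\prod_j block_law q (u j) <= row_threshold n m * v2 ^+ 2 *
        \prod_j (marg1 (block_law q) (u j).1 * marg2 (block_law q) (u j).2))%R%:R <= d2 ->
  error_prob q matcher n m L <=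
  (n * (n * smax))%N%:R * (((L.+1 ^ (k * k))%N)%:R / column_threshold n L
       + 2 * ((L.+1 ^ k)%N)%:R / v1 + d1)
  + (((n.+1 ^ #|'I_k|)%N)%:R / v2 + ((n.+1 ^ #|{: block}|)%N)%:R / v2 + d2)
  + m%:R * (((n.+1 ^ (#|'I_k| * #|{: block}|))%N)%:R / row_threshold n m).
Proof.
move=> m0 v10 v20 le_d1 le_d2; have mR : 0 < m%:R :> R by rewrite ltr0n.
rewrite error_probE.
set B1 := (n * (n * smax))%N%:R * _; set B2 := (_ + _ + d2); set B3 := m%:R * _.
pose e1 := fun (S : {ffun 'I_n -> 'I_smax.+1}) (G1 : 'M['I_k]_(L, n)) (G2 : 'M['I_k]_(L, ncols S)) =>
  \sum_j \sum_c (detected G1 G2 j c != (col_of c == j))%:R : R.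
pose tau := row_threshold n m.
pose e2 (x : {ffun 'I_n -> 'I_k}) (b : {ffun 'I_n -> block}) := (score R (zips x b) <= tau)%R%:R : R.
pose e3 (x : {ffun 'I_n -> 'I_k}) (b : {ffun 'I_n -> block}) := (tau < score R (zips x b))%R%:R : R.
pose kap := fun (S : {ffun 'I_n -> 'I_smax.+1}) (sigma : 'S_m) (X : 'M['I_k]_(m, n)) Y =>
  @noisy_pmf R k smax q m n S sigma X Y.
apply: le_trans (_ : expect_with q kap (fun S X sigma Y (G1 : 'M['I_k]_(L, n)) G2 =>
   e1 S G1 G2 + m%:R^-1 * (\sum_i e2 (row_of X i) (blocks S (row_of Y (sigma i))) +
      \sum_i \sum_i' (if i' != i then e3 (row_of X i) (blocks S (row_of Y (sigma i'))) else 0)))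
   <= _).
  apply: expect_le => S X sigma Y G1 G2.
  (* The column term does not depend on the row, so it equals its own average over rows. *)
  have -> : e1 S G1 G2 = m%:R^-1 * \sum_(i < m) e1 S G1 G2.
    by rewrite sumr_const card_ord -[X in _ * X]mulr_natl mulrA mulVf ?mul1r // gt_eqF.
  rewrite -mulrDr ler_wpM2l ?invr_ge0 // -!big_split /=; apply: ler_sum => i _.
  by rewrite addrA -big_mkcond; apply: matcher_error.
rewrite expect_withD expect_withZ expect_withD -addrA.
apply: lerD.
  rewrite (expect_seeds q m e1) -[leRHS]mul1r -(sum_pattern q n) mulr_suml.
  apply: ler_sum => S _; rewrite ler_wpM2l ?pattern_pmf_ge0 // /e1.
  rewrite seed_expect_sum; under eq_bigr do rewrite seed_expect_sum.
  apply: le_trans (_ : \sum_(j < n) \sum_(c < ncols S) _ <= _).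
    by do 2![apply: ler_sum => ? _]; apply: detection_error v10 le_d1.
  rewrite sumr_const sumr_const !card_ord -mulrnA -[leLHS]mulr_natl ler_wpM2r //.
    rewrite !addr_ge0 // ?divr_ge0 ?mulr_ge0 ?ler0n ?(ltW v10) //.
    apply: le_trans le_d1; apply: sumr_ge0 => u _.
    by rewrite mulr_ge0 ?prodr_ge0 // => l _; apply: letter_law_ge0.
  rewrite ler_nat mulnC leq_mul2l; apply/orP; right.
  rewrite -[X in (_ <= X * _)%N]card_ord -sum_nat_const.
  by apply: leq_sum => j _; rewrite -ltnS ltn_ord.
have avg (F : 'I_m -> R) b : (forall i, F i <= b) -> m%:R^-1 * \sum_i F i <= b.
  move=> Fb; rewrite ler_pdivrMl //; apply: le_trans (ler_sum _ (fun i _ => Fb i)) _.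
  by rewrite sumr_const card_ord -[leLHS]mulr_natl.
rewrite mulrDr; apply: lerD.
  rewrite expect_with_sum; apply: avg => i.
  rewrite (expect_row q L i (fun=> i) e2).
  under eq_bigr do rewrite row_expect_same.
  apply: sum_perm_le; under eq_bigr do rewrite /e2 zips_fsts_snds.
  apply: le_trans (score_joint (block_law_ge0 q) (sum_block_law q) _ _ v20) _.
  by rewrite lerD2l.
rewrite expect_with_sum; apply: avg => i.
rewrite expect_with_sum.
apply: le_trans (_ : \sum_(i' < m) (((n.+1 ^ (#|'I_k| * #|{: block}|))%N)%:R / row_threshold n m) <= _);
  last by rewrite sumr_const (card_ord m) /B3 [leRHS]mulr_natl.
have t0 : 0 < row_threshold n m by rewrite ltr0n muln_gt0 m0 expn_gt0.
apply: ler_sum => i' _; have [->|ne] := eqVneq i' i.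
  by rewrite expect_const divr_ge0 // ltW.
rewrite (expect_row q L i (fun=> i') e3).
under eq_bigr do rewrite row_expect_diff 1?eq_sym //.
apply: sum_perm_le; under eq_bigr do rewrite /e3 zips_fsts_snds.
apply: score_indep => //.
- exact: pX_ge0.
- by rewrite pX_sum1.
- exact: (marg2_ge0 (block_law_ge0 q)).
- by rewrite (sum_marg2 (sum_block_law q)).
Qed.

End Matcher.

Local Open Scope classical_set_scope.
Local Open Scope ring_scope.

(** * Asymptotics *)

Section Asymptotics.
Variable R : realType.

Lemma ln2_gt0 : 0 < ln 2 :> R. Proof. by rewrite ln_gt0 // ltr1n. Qed.

(** The term of degree [D.+1] of the exponential series suffices: with [n.+1 <= 2 * n], it dominates
    once [n] exceeds [C]. *)
Lemma expn_le_expR (D : nat) (a : R) : 0 < a ->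
  \forall n \near \oo, ((n.+1 ^ D)%N)%:R <= expR (n%:R * a).
Proof.
move=> a0; pose C : R := 2 ^+ D * (D.+1)`!%:R / a ^+ D.+1.
have aD : 0 < a ^+ D.+1 by rewrite exprn_gt0.
near=> n.
have n0 : (0 < n)%N by near: n; exact: nbhs_infty_gt.
have nC : C <= n%:R by near: n; exact: nbhs_infty_ger.
have na0 : 0 <= n%:R * a by rewrite mulr_ge0 // ltW.
apply: le_trans (_ : (n%:R * a) ^+ D.+1 / (D.+1)`!%:R <= _); last first.
  by apply: le_trans (expR_ge1Dxn D na0); rewrite lerDr.
rewrite ler_pdivlMr ?ltr0n ?fact_gt0 // natrX.
apply: le_trans (_ : (2 * n%:R) ^+ D * (D.+1)`!%:R <= _).
  rewrite ler_wpM2r // lerXn2r ?nnegrE ?mulr_ge0 //.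
  by rewrite -natrM ler_nat mul2n -addnn -addn1 leq_add2l.
rewrite !exprMn [n%:R ^+ D.+1]exprS.
have -> : 2 ^+ D * n%:R ^+ D * (D.+1)`!%:R = C * n%:R ^+ D * a ^+ D.+1.
  by rewrite /C; field; rewrite gt_eqF.
by rewrite ler_wpM2r ?(ltW aD) // ler_wpM2r // exprn_ge0.
Unshelve. all: by end_near.
Qed.

Lemma superlogarithmic_ge (L : nat -> nat) (M : R) : superlogarithmic R L ->
  \forall n \near \oo, M * ln n.+1%:R <= (L n)%:R.
Proof.
(* The factor 2 comes from [ln n.+1 <= 2 * ln n] for [n >= 2], and [ln 2] from the change of
   base. *)
move=> /cvgryPge /(_ (`|M| * 2 * ln 2)) hL.
near=> n.
have n2 : (1 < n)%N by near: n; exact: nbhs_infty_gt.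
have nR : 0 < n%:R :> R by rewrite ltr0n ltnW.
have lnn : 0 < ln n%:R :> R by rewrite ln_gt0 // ltr1n.
have : `|M| * 2 * ln 2 <= (L n)%:R / log2 n%:R by near: n; exact: hL.
rewrite /log2 invf_div mulrA ler_pdivlMr // mulrAC ler_pM2r ?ln2_gt0 // => h.
apply: le_trans h; rewrite -mulrA.
have ln1 : 0 <= ln n.+1%:R :> R by rewrite ln_ge0 // ler1n.
apply: le_trans (_ : `|M| * ln n.+1%:R <= _).
  by rewrite ler_wpM2r // ler_norm.
rewrite ler_wpM2l // mulr_natl -lnXn // ler_ln ?posrE ?exprn_gt0 //.
rewrite -natrX ler_nat -addn1 expnS expn1.
apply: (@leq_trans (n + n)); first by rewrite leq_add2l ltnW.
by rewrite addnn -mul2n leq_mul2r n2 orbT.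
Unshelve. all: by end_near.
Qed.

Lemma superlogarithmic_infty (L : nat -> nat) (N : nat) : superlogarithmic R L ->
  \forall n \near \oo, (N <= L n)%N.
Proof.
move=> hL; near=> n.
have n1 : (0 < n)%N by near: n; exact: nbhs_infty_gt.
rewrite -(ler_nat R).
have : N%:R / ln 2 * ln n.+1%:R <= (L n)%:R :> R by near: n; exact: superlogarithmic_ge.
apply: le_trans; rewrite mulrAC ler_pdivlMr ?ln2_gt0 // ler_wpM2l //.
by rewrite ler_ln ?posrE // ler_nat ltnS.
Unshelve. all: by end_near.
Qed.

Lemma exprn_expR (n : nat) (x : R) : 0 < x -> x ^+ n = expR (n%:R * ln x).
Proof. by move=> x0; rewrite expRM_natl lnK. Qed.

(** Half of the exponent absorbs the power of [n.+1], by superlogarithmic growth, and the other half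
    the power of [(L n).+1], since [L n] tends to infinity. *)
Lemma superlogarithmic_poly (L : nat -> nat) (D E : nat) (a : R) :
  superlogarithmic R L -> 0 < a ->
  \forall n \near \oo, ((n.+1 ^ D * (L n).+1 ^ E)%N)%:R <= expR ((L n)%:R * a).
Proof.
move=> hL a0; have a20 : 0 < a / 2 by rewrite divr_gt0.
have [N _ hN] := expn_le_expR E a20.
near=> n.
have hNL : (N <= L n)%N by near: n; exact: superlogarithmic_infty.
have hD : D%:R / (a / 2) * ln n.+1%:R <= (L n)%:R.
  by near: n; exact: superlogarithmic_ge.
have -> : (L n)%:R * a = (L n)%:R * (a / 2) + (L n)%:R * (a / 2) by field.
rewrite expRD natrM; apply: ler_pM => //; last exact: (hN (L n) hNL).
rewrite natrX exprn_expR // ler_expR -ler_pdivrMr //.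
by rewrite mulrAC.
Unshelve. all: by end_near.
Qed.

Lemma superlogarithmic_exp (L : nat -> nat) (b : R) :
  superlogarithmic R L -> 0 <= b -> b < 1 ->
  \forall n \near \oo, (n * n)%N%:R * b ^+ L n <= n.+1%:R^-1.
Proof.
(* Raising [b] to at least [1 / 2] keeps the base positive, since [b] may be 0. The constant 3 used
   below makes [c ^+ L n] at most the inverse cube of [n.+1]. *)
move=> hL b0 b1; pose c := Num.max b (1 / 2).
have c0 : 0 < c by rewrite lt_max; apply/orP; right; rewrite divr_gt0.
have c1 : c < 1 by rewrite gt_max b1; lra.
have lnc : 0 < - ln c by rewrite oppr_gt0 ln_lt0 // c0.
near=> n.
have h : 3 / - ln c * ln n.+1%:R <= (L n)%:R by near: n; exact: superlogarithmic_ge.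
have bc : b ^+ L n <= c ^+ L n.
  by rewrite lerXn2r ?nnegrE ?(ltW c0) // le_max lexx.
apply: le_trans (_ : n.+1%:R ^+ 2 * n.+1%:R ^- 3 <= _); last first.
  have xE (x : R) : x != 0 -> x ^+ 2 * x ^- 3 <= x^-1.
    by move=> x0; rewrite le_eqVlt; apply/orP; left; apply/eqP; field.
  by apply: xE; rewrite pnatr_eq0.
apply: ler_pM; rewrite ?exprn_ge0 //.
  by rewrite -natrX ler_nat expnS expn1 leq_mul.
apply: le_trans bc _; rewrite exprn_expR // [n.+1%:R ^+ 3]exprn_expR // -expRN ler_expR.
move: h; rewrite mulrAC ler_pdivrMr //; lra.
Unshelve. all: by end_near.
Qed.

Lemma growth_rate_le (m : nat -> nat) (r e : R) : (forall n, (0 < m n)%N) ->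
  has_growth_rate m r -> 0 < e ->
  \forall n \near \oo, (m n)%:R <= expR (n%:R * (r * ln 2 + e)).
Proof.
move=> m0 hm e0.
have lt_r : r < r + e / ln 2 by rewrite ltrDl divr_gt0 // ln2_gt0.
near=> n.
have n0 : 0 < n%:R :> R by rewrite ltr0n; near: n; exact: nbhs_infty_gt.
have : log2 (m n)%:R / n%:R <= r + e / ln 2 by near: n; apply: cvgr_le lt_r.
rewrite /log2 ler_pdivrMr // ler_pdivrMr ?ln2_gt0 // => h.
rewrite -[leLHS]lnK ?posrE ?ltr0n // ler_expR; apply: le_trans h _.
rewrite le_eqVlt; apply/orP; left; apply/eqP; field.
by rewrite gt_eqF // ln2_gt0.
Unshelve. all: by end_near.
Qed.

(** Take [m n] to be the integer part of [2 ^ (n r)] plus 1: rounding up gives the lower bound on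
    [ln (m n)] that the converse needs, and costs at most a factor 2. *)
Lemma growth_rate_ex (r : R) : 0 < r ->
  exists2 m : nat -> nat, has_growth_rate m r &
    forall n, (0 < m n)%N /\ n%:R * (r * ln 2) <= ln (m n)%:R.
Proof.
move=> r0; pose x n := expR (n%:R * (r * ln 2)).
have rl0 : 0 < r * ln 2 by rewrite mulr_gt0 // ln2_gt0.
have x1 n : 1 <= x n by rewrite -expR0 ler_expR mulr_ge0 // ltW.
exists (fun n => (Num.truncn (x n)).+1); last first.
  move=> n; split=> //; rewrite -ler_expR lnK ?posrE //.
  by have /andP [_ /ltW] := truncn_itv (le_trans ler01 (x1 n)).
have lower n : n%:R * (r * ln 2) <= ln (Num.truncn (x n)).+1%:R.
  rewrite -ler_expR lnK ?posrE //.
  by have /andP [_ /ltW] := truncn_itv (le_trans ler01 (x1 n)).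
have upper n : ln (Num.truncn (x n)).+1%:R <= ln 2 + n%:R * (r * ln 2).
  rewrite -ler_expR expRD !lnK ?posrE // -/(x n) -addn1 natrD mulrDl mul1r lerD //.
  by have /andP [] := truncn_itv (le_trans ler01 (x1 n)).
apply/cvgrPdist_le => e e0; near=> n.
have n0 : 0 < n%:R :> R by rewrite ltr0n; near: n; exact: nbhs_infty_gt.
have ne : e^-1 <= n%:R by near: n; exact: nbhs_infty_ger.
rewrite distrC ler_distl /log2; apply/andP; split.
  apply: le_trans (_ : r <= _); first by rewrite gerBl ltW.
  rewrite ler_pdivlMr // ler_pdivlMr ?ln2_gt0 //.
  by have -> : r * n%:R * ln 2 = n%:R * (r * ln 2) by ring.
rewrite ler_pdivrMr // ler_pdivrMr ?ln2_gt0 //; apply: le_trans (upper n) _.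
have -> : (r + e) * n%:R * ln 2 = e * n%:R * ln 2 + n%:R * (r * ln 2) by ring.
rewrite lerD2r ler_peMl ?(ltW ln2_gt0) //.
by rewrite -ler_pdivrMl // mulr1.
Unshelve. all: by end_near.
Qed.

End Asymptotics.

(** * Capacity *)

Section Capacity.
Variables (R : realType) (k' smax : nat).
Notation k := k'.+1.
Notation block := {s : 'I_smax.+1 & {ffun 'I_s -> 'I_k}}.
Variable q : source R k smax.
Hypothesis pX_gt0 : forall x, 0 < pX q x.
Hypothesis pS_gt0 : forall s, 0 < pS q s.

(** If a single copy were independent of its letter, all rows of the channel would agree, as [pX] is
    positive, and whole blocks would be independent of the letter too. So whenever a positive rate
    is sought, seed columns can be told apart. *)
Lemma mutual_nats_letter_gt0 :
  0 < mutual_nats (block_law q) -> 0 < mutual_nats (letter_law q).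
Proof.
move=> I0.
have [/existsP [v ne]|/existsPn indep] := boolP
    [exists v, letter_law q v != marg1 (letter_law q) v.1 * marg2 (letter_law q) v.2].
  exact: (mutual_nats_gt0 (letter_law_ge0 q) (sum_letter_law q) ne).
have chanE x y : chan q x y = marg2 (letter_law q) y.
  have /negPn/eqP := indep (x, y); rewrite /= marg1_letter_law.
  by apply: mulfI; rewrite gt_eqF.
have blockE x b : block_law q (x, b) = marg1 (block_law q) x * marg2 (block_law q) b.
  rewrite marg1_block_law /block_law /=; congr (_ * _); rewrite /marg2 /=.
  have bE x' : block_chan q x' b = block_chan q x b.
    by rewrite /block_chan; congr (_ * _); apply: eq_bigr => t _; rewrite !chanE.
  under eq_bigr do rewrite bE.
  by rewrite -mulr_suml pX_sum1 mul1r.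
move: I0; rewrite /mutual_nats big1 ?ltxx // => -[x b] _.
rewrite /info_density /= -blockE.
have [->|nz] := eqVneq (block_law q (x, b)) 0; first by rewrite mul0r.
by rewrite divff // ln1 mulr0.
Qed.

Lemma error_prob_ge0 psi n m L : 0 <= error_prob q psi n m L.
Proof.
do 7![apply: sumr_ge0 => ? _].
by rewrite !mulr_ge0 ?invr_ge0 ?pattern_pmf_ge0 ?iid_pmf_ge0 ?noisy_pmf_ge0.
Qed.

(** Arithmetic of the final bound: [s] stands for [smax], [N] for [n * n], [y] for the inverse of
    [n.+1], and [h] for the Chernoff term of the rows. *)
Lemma error_terms_le (s N p w f g h y : R) :
  0 <= s -> N * p <= y -> N * w <= y -> f <= y -> g <= y ->
  N * s * (p + 2 * p + w) + (f + g + h) + y <= (4 * s + 3) * y + h.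
Proof.
move=> s_ge0 Np Nw fy gy.
have := ler_wpM2l s_ge0 Np; have := ler_wpM2l s_ge0 Nw; lra.
Qed.

Lemma achievable_matcher (L : nat -> nat) (r : R) : superlogarithmic R L ->
  0 < r -> r < cond_mutual_info q ->
  achievable [set @matcher R k' smax] q L r.
Proof.
move=> hL r0; rewrite cond_mutual_infoE // ltr_pdivlMr ?ln2_gt0 // => lt_rI.
split=> // m m0 hm; exists (@matcher R k' smax) => //.
set I := mutual_nats (block_law q) in lt_rI.
have I0 : 0 < I by apply: lt_trans lt_rI; rewrite mulr_gt0 // ln2_gt0.
have I10 := mutual_nats_letter_gt0 I0; set I1 := mutual_nats (letter_law q) in I10.
(* The column threshold is polynomial, so any margin below [I1] works. For rows, the gap is cut in
   three: one part for the growth of [m], one for polynomial factors, one for the Chernoff bound. *)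
pose e1 := I1 / 2; have e10 : 0 < e1 by rewrite divr_gt0.
pose e := (I - r * ln 2) / 3; have e0 : 0 < e by rewrite divr_gt0 // subr_gt0.
have [b1 [b10 b11 hb1]] := chernoff (letter_law_ge0 q) (sum_letter_law q) e10.
have [b2 [b20 b21 hb2]] := chernoff (block_law_ge0 q) (sum_block_law q) e0.
pose A := #|'I_k|; pose B := #|{: block}|.
(* The slacks of [score_joint]: numbers of types times a power of [n.+1], namely the fourth, against
   the union bound over columns, or at least the first for rows. *)
pose v1 n : R := ((n.+1 ^ 4 * (L n).+1 ^ k)%N)%:R.
pose v2 n : R := ((n.+1 ^ (A + B).+1)%N)%:R.
have cond1 : \forall n \near \oo,
    column_threshold R k' n (L n) * v1 n ^+ 2 <= expR ((L n)%:R * (I1 - e1)).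
  have e1E : I1 - e1 = e1 by rewrite /e1; field.
  rewrite e1E; near=> n.
  (* The exponents add those of the threshold and twice those of [v1]: [12 = 4 + 2 * 4]. *)
  have h : ((n.+1 ^ 12 * (L n).+1 ^ (k * k + (k + k)))%N)%:R <= expR ((L n)%:R * e1).
    by near: n; apply: superlogarithmic_poly.
  apply: le_trans h; rewrite /column_threshold /v1 -natrX -natrM ler_nat.
  by rewrite expnMn -!expnM mulnACA -!expnD !muln2 addnn.
have cond2 : \forall n \near \oo,
    row_threshold R k' smax n (m n) * v2 n ^+ 2 <= expR (n%:R * (I - e)).
  near=> n.
  have h1 : ((n.+1 ^ ((A * B).+1 + ((A + B).+1 + (A + B).+1)))%N)%:R <= expR (n%:R * e).
    by near: n; apply: expn_le_expR.
  have h2 : (m n)%:R <= expR (n%:R * (r * ln 2 + e)).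
    by near: n; apply: growth_rate_le.
  have -> : n%:R * (I - e) = n%:R * (r * ln 2 + e) + n%:R * e by rewrite /e; field.
  rewrite expRD; apply: le_trans (ler_pM _ _ h2 h1) => //.
  rewrite /row_threshold /v2 -natrX -!natrM ler_nat -mulnA.
  by rewrite -expnM -expnD muln2 addnn.
have bound : \forall n \near \oo, 0 <= error_prob q (@matcher R k' smax) n (m n) (L n) <=
    (4 * smax + 3)%N%:R * n.+1%:R^-1 + b2 ^+ n.
  near=> n; rewrite error_prob_ge0 /=.
  have c1 : column_threshold R k' n (L n) * v1 n ^+ 2 <= expR ((L n)%:R * (I1 - e1)) by near: n.
  have c2 : row_threshold R k' smax n (m n) * v2 n ^+ 2 <= expR (n%:R * (I - e)) by near: n.
  have c3 : (n * n)%N%:R * b1 ^+ L n <= n.+1%:R^-1 by near: n; apply: superlogarithmic_exp.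
  have v10 : 0 < v1 n by rewrite ltr0n muln_gt0 !expn_gt0.
  have v20 : 0 < v2 n by rewrite ltr0n expn_gt0.
  apply: le_trans (matcher_error_prob (m0 n) v10 v20 (hb1 _ _ c1) (hb2 _ _ c2)) _.
  have y0 : 0 < n.+1%:R :> R by rewrite ltr0n.
  have nz a : ((n.+1 ^ a)%N)%:R != 0 :> R by rewrite pnatr_eq0 expn_eq0.
  have t1 a : (((L n).+1 ^ a)%N)%:R / ((n.+1 ^ 4 * (L n).+1 ^ a)%N)%:R = n.+1%:R ^- 4 :> R.
    by rewrite natrM invfM mulrCA divff // mulr1 natrX.
  have t2 a : (a <= A + B)%N -> ((n.+1 ^ a)%N)%:R / v2 n <= n.+1%:R^-1.
    move=> aAB; rewrite ler_pdivrMr // -ler_pdivrMl ?invr_gt0 // invrK -natrM -expnS.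
    by rewrite ler_nat leq_pexp2l.
  have t3 : (m n)%:R * (((n.+1 ^ (#|'I_k| * #|{: block}|))%N)%:R / row_threshold R k' smax n (m n)) =
      n.+1%:R^-1.
    have cancel_mid (u v w : R) : u != 0 -> v != 0 -> w != 0 -> u * (w / (u * (v * w))) = v^-1.
      by move=> u0 v0 w0; field; rewrite u0 v0 w0.
    rewrite /row_threshold expnS [((m n * _)%N)%:R]natrM [((n.+1 * _)%N)%:R]natrM.
    by apply: cancel_mid; rewrite ?nz // pnatr_eq0 -?lt0n ?m0.
  have t4 : (n * n)%N%:R * n.+1%:R ^- 4 <= n.+1%:R^-1 :> R.
    rewrite -ler_pdivlMr ?invr_gt0 ?exprn_gt0 // invrK.
    have -> : n.+1%:R^-1 * n.+1%:R ^+ 4 = n.+1%:R ^+ 3 :> R.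
      by rewrite [X in _ * X]exprS mulKf // gt_eqF.
    rewrite -natrX ler_nat; apply: leq_trans (_ : n.+1 ^ 2 <= _)%N; last by rewrite leq_pexp2l.
    by rewrite expnS expn1 leq_mul.
  rewrite t3 -[2 * _ / _]mulrA !t1 mulnA [((n * n * smax)%N)%:R]natrM.
  have t2A := t2 A (leq_addr B A); have t2B := t2 B (leq_addl A B).
  have s0 : 0 <= smax%:R :> R by [].
  rewrite natrD [((4 * smax)%N)%:R]natrM.
  exact: error_terms_le.
apply: (squeeze_cvgr bound); first exact: cvg_cst.
rewrite -[X in _ --> X](addr0 0) -[X in _ --> X + _](mulr0 (4 * smax + 3)%N%:R).
apply: cvgD; first by apply: cvgM; [exact: cvg_cst|exact: cvg_harmonic].
by apply: cvg_expr; rewrite ger0_norm.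
Unshelve. all: by end_near.
Qed.

(** Above the mutual information, the converse bound fails for large [n] along a sequence [m] of
    growth rate [r]. The scheme is arbitrary, so the bound holds for every class [A]. *)
Lemma achievable_le (A : set (scheme k smax)) (L : nat -> nat) (r : R) :
  achievable A q L r -> r <= cond_mutual_info q.
Proof.
move=> [r0 ach]; rewrite cond_mutual_infoE // ler_pdivlMr ?ln2_gt0 // leNgt; apply/negP => lt_Ir.
have [m hm mP] := growth_rate_ex r0.
have [psi _ err0] := ach m (fun n => (mP n).1) hm.
set I := mutual_nats (block_law q) in lt_Ir.
have I0 : 0 <= I := mutual_nats_ge0 (block_law_ge0 q) (sum_block_law q).
pose x := r * ln 2; have x0 : 0 < x by rewrite mulr_gt0 // ln2_gt0.
pose g := x - I; have g0 : 0 < g by rewrite subr_gt0.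
(* An error below [g / (2 * x)] loses only half of the gap [g] per column; the remaining
   [n * (g / 2)] eventually exceeds the constant of the converse. *)
have d0 : 0 < g / (2 * x) by rewrite divr_gt0 // mulr_gt0.
near \oo => n.
have err : `|error_prob q psi n (m n) (L n)| < g / (2 * x).
  by near: n; apply: cvgr0_norm_lt.
have big : ln (2 * expR 1) / (g / 2) < n%:R by near: n; apply: nbhs_infty_gtr.
move: err; rewrite ger0_norm ?error_prob_ge0 // => err.
have [m0 lnm] := mP n; rewrite -/x in lnm.
have conv := error_prob_converse pX_gt0 pS_gt0 psi n (L n) m0; rewrite -/I in conv.
set err_n := error_prob _ _ _ _ _ in err conv.
have d1 : g / (2 * x) <= 1 / 2.
  rewrite ler_pdivrMr; last by rewrite mulr_gt0.
  by rewrite /g; lra.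
have n0 : 0 <= n%:R :> R by [].
have low : (1 - g / (2 * x)) * (n%:R * x) <= (1 - err_n) * ln (m n)%:R.
  apply: ler_pM => //.
  - by rewrite subr_ge0 (le_trans d1) //; lra.
  - by rewrite mulr_ge0 // ltW.
  - by rewrite lerD2l lerN2 ltW.
have eq1 : (1 - g / (2 * x)) * (n%:R * x) = n%:R * I + n%:R * (g / 2).
  by rewrite /g; field; rewrite gt_eqF.
move: big; rewrite ltr_pdivrMr ?divr_gt0 // => big.
by have := le_trans low conv; rewrite eq1 lerD2l leNgt big.
Unshelve. all: by end_near.
Qed.

End Capacity.

(** If the supremum were below [c], the midpoint between it and [c] would be an achievable rate
    above it. The element 0 of the set makes this midpoint positive. *)
Lemma capacityE (R : realType) (k smax : nat) (A : set (scheme k smax))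
    (q : source R k smax) (L : nat -> nat) (c : R) : 0 <= c ->
  (forall r, 0 < r -> r < c -> achievable A q L r) ->
  (forall r, achievable A q L r -> r <= c) ->
  capacity A q L = c%:E.
Proof.
move=> c0 low up; apply/le_anti/andP; split.
  by apply: ge_ereal_sup => _ [[r /up le_rc <-]|->]; rewrite lee_fin.
rewrite leNgt; apply/negP; rewrite /capacity; set C := ereal_sup _ => lt_C.
have C0 : (0 <= C)%E by apply: ereal_sup_ubound; right.
have Cfin : C \is a fin_num by rewrite ge0_fin_numE // (lt_le_trans lt_C) // leey.
rewrite -(fineK Cfin) lee_fin in C0; rewrite -(fineK Cfin) lte_fin in lt_C.
have r0 : 0 < (fine C + c) / 2 by rewrite divr_gt0 //; lra.
have : (((fine C + c) / 2)%:E <= (fine C)%:E)%E.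
  rewrite fineK //; apply: ereal_sup_ubound; left; exists ((fine C + c) / 2) => //.
  by apply: low => //; rewrite ltr_pdivrMr //; lra.
by rewrite lee_fin ler_pdivrMr //; lra.
Qed.

Unset Implicit Arguments.

Theorem theorem1 (R : realType) (k smax : nat) :
  exists psi0 : scheme k smax,
  forall (q : source R k smax) (L : nat -> nat),
    (forall x, 0 < pX q x) ->
    (forall s, 0 < pS q s) ->
    superlogarithmic R L ->
    capacity [set psi0] q L = (cond_mutual_info q)%:E /\
    capacity [set: scheme k smax] q L = (cond_mutual_info q)%:E.
Proof.
(* Over an empty alphabet no source exists, since an empty sum is not 1; any scheme will do. *)
case: k => [|k].
  exists (fun _ _ _ _ _ _ _ _ _ => None) => q.
  by have := pmf_sum1 (pX q); rewrite big_ord0 => /eqP; rewrite eq_sym oner_eq0.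
exists (@matcher R k smax) => q L pX0 pS0 hL.
have I0 : 0 <= cond_mutual_info q.
  rewrite cond_mutual_infoE // divr_ge0 ?(ltW (ln2_gt0 R)) //.
  exact: mutual_nats_ge0 (block_law_ge0 q) (sum_block_law q).
split; apply: capacityE => // r; try exact: achievable_le.
  by move=> r0 rI; apply: achievable_matcher.
(* Achievability by the single matcher passes to the class of all schemes. *)
move=> r0 rI; have [_ ach] := achievable_matcher pX0 pS0 hL r0 rI.
by split=> // m m0 hm; have [psi _ ?] := ach m m0 hm; exists psi.
Qed.
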